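(* Let $\Lambda\subset\mathbb Z$ be a finite centrally symmetric set ($-\Lambda=\Lambda$), nonempty and different from $\{0\}$, and let $f_\Lambda$ be a random real Laurent polynomial with spectrum $\Lambda$, i.e. a random element of $\mathrm{Trig}(\Lambda)$ distributed according to the standard Gaussian measure associated with the scalar product $(f,g)=\frac{1}{2\pi}\int_0^{2\pi} f(\theta)g(\theta)\,d\theta$. Let $\mathcal P(\Lambda)$ denote the probability that a root of $f_\Lambda$ is real. Then: (a) the expected number of real roots of $f_\Lambda$ equals $$2\sqrt{\frac{1}{\#\Lambda}\sum_{\lambda\in\Lambda}\lambda^2},$$ where $\#\Lambda$ is the number of elements of $\Lambda$; (b) $$\mathcal P(\Lambda)=\frac{1}{\deg(f_\Lambda)}\sqrt{\frac{1}{\#\Lambda}\sum_{\lambda\in\Lambda}\lambda^2},\qquad \deg(f_\Lambda)=\max_{\lambda\in\Lambda}|\lambda|;$$ (c) for every nonzero integer $k$, with $k\Lambda=\{k\lambda:\lambda\in\Lambda\}$, one has $\mathcal P(k\Lambda)=\mathcal P(\Lambda)$.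
   Context: A Laurent polynomial with spectrum $\Lambda$ ($\Lambda\subset\mathbb Z$ finite) is a function $P(z)=\sum_{\lambda\in\Lambda}a_\lambda z^\lambda$ on $\mathbb C\setminus\{0\}$, with $a_\lambda\in\mathbb C$. Let $S=\{z\in\mathbb C: |z|=1\}$, parametrized by $z=e^{i\theta}$. A Laurent polynomial is called real if its values on $S$ are real; equivalently $a_{-\lambda}=\overline{a_\lambda}$ for all $\lambda$. A real root of a Laurent polynomial is a root lying in $S$. The degree of a real Laurent polynomial with spectrum $\Lambda$ is $\max_{\lambda\in\Lambda}|\lambda|$. For finite centrally symmetric $\Lambda\subset\mathbb Z$, $\mathrm{Trig}(\Lambda)$ denotes the real vector space (of dimension $\#\Lambda$) of real-valued functions $\theta\mapsto\sum_{\lambda\in\Lambda}a_\lambda e^{i\lambda\theta}$, $a_{-\lambda}=\overline{a_\lambda}$, i.e. of restrictions to $S$ of real Laurent polynomials with spectrum $\Lambda$. It is a Euclidean space with scalar product $(f,g)=\frac1{2\pi}\int_0^{2\pi} f(\theta)g(\theta)\,d\theta$. A random real Laurent polynomial with spectrum $\Lambda$ is a random element of $\mathrm{Trig}(\Lambda)$ whose coordinates in an orthonormal basis are independent standard normal variables. The probability $\mathcal P(\Lambda)$ that a root of $f_\Lambda$ is real is the expected number of real roots of $f_\Lambda$ divided by the almost sure number $2\max_{\lambda\in\Lambda}|\lambda|$ of all roots of $f_\Lambda$ in $\mathbb C\setminus\{0\}$, counted with multiplicity. *)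

(* Defs.v *)
From HB Require Import structures.
From mathcomp Require Import all_boot all_order all_algebra finmap complex.
From mathcomp Require Import all_classical all_reals all_analysis.

Set Implicit Arguments.
Unset Strict Implicit.
Unset Printing Implicit Defensive.

Import Order.TTheory GRing.Theory Num.Theory.
Import numFieldNormedType.Exports.

Local Open Scope classical_set_scope.
Local Open Scope ring_scope.

Section Laurent.
Variables (R : realType) (L : {fset int}).

(* A Laurent polynomial with spectrum [L] is given by a coefficient family
   [a : int -> R[i]]; only the coefficients with index in [L] matter. *)
Definition laurent (a : int -> R[i]) (z : R[i]) : R[i] :=
  \sum_(l <- L) a l * z ^ l.

(* e^(i t) *)
Definition expi (t : R) : R[i] := Complex (cos t) (sin t).

Definition degree : nat := \max_(l <- L) absz l.

Definition real_roots (a : int -> R[i]) : set R[i] :=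
  [set z | `|z| = 1 /\ laurent a z = 0].

(* The polynomial z^degree * laurent a z (all the exponents l + degree are
   nonnegative); it has the same roots in C \ {0}, with the same
   multiplicities, as [laurent a]. *)
Definition laurent_poly (a : int -> R[i]) : {poly R[i]} :=
  \sum_(l <- L) a l *: 'X^(absz (l + degree%:Z)).

(* Number of roots in C \ {0}, counted with multiplicity.  The zero Laurent
   polynomial gets a junk value. *)
Definition root_count (a : int -> R[i]) : nat :=
  \sum_(z \in [set z : R[i] | z != 0]) mup z (laurent_poly a).

Definition Trig : set (R -> R) :=
  [set f | exists a : int -> R[i],
     (forall l, l \in L -> a (- l) = (a l)^*%C) /\
     (forall t, (f t)%:C%C = laurent a (expi t))].

End Laurent.

Definition scale_spectrum (k : int) (L : {fset int}) : {fset int} :=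
  [fset k * l | l in L]%fset.

Section OrthonormalBasis.
Variable R : realType.

Definition dot (f g : R -> R) : R :=
  (2 * pi)^-1 * \int[lebesgue_measure]_(t in `[0, 2 * pi]) (f t * g t).

Definition orthonormal_basis (L : {fset int}) (e : 'I_#|` L| -> R -> R) : Prop :=
  [/\ forall i, Trig L (e i),
      forall i j, dot (e i) (e j) = (i == j)%:R
    & forall f, Trig L f ->
        exists c : 'I_#|` L| -> R, forall t, f t = \sum_i c i * e i t].

End OrthonormalBasis.

Section RandomLaurent.
Context (d : measure_display) (T : measurableType d) (R : realType).
Variable P : probability T R.

Definition independent_RVs (n : nat) (X : 'I_n -> {RV P >-> R}) : Prop :=
  forall (J : {set 'I_n}) (B : 'I_n -> set R), (forall i, measurable (B i)) ->
    P (\bigcap_(i in [set` J]) (X i @^-1` B i)) =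
    (\prod_(i in J) P (X i @^-1` B i))%E.

Definition standard_normal (X : {RV P >-> R}) : Prop :=
  forall B : set R, measurable B -> distribution P X B = normal_prob 0 1 B.

(* [F w] is the coefficient family of the Laurent polynomial drawn at [w]; its
   restriction to the unit circle is the element of [Trig L] with coordinates
   [X i w] in the orthonormal basis [e]. *)
Definition random_real_laurent (L : {fset int}) (F : T -> int -> R[i]) : Prop :=
  exists (e : 'I_#|` L| -> R -> R) (X : 'I_#|` L| -> {RV P >-> R}),
    [/\ orthonormal_basis e,
        independent_RVs X,
        (forall i, standard_normal (X i))
      & forall w t, laurent L (F w) (expi t) = (\sum_i X i w * e i t)%:C%C].

Definition expected_real_roots (L : {fset int}) (F : T -> int -> R[i]) : \bar R :=
  (\int[P]_w counting (real_roots L (F w)))%E.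

(* The almost sure number of roots in C \ {0}, counted with multiplicity (junk
   value 0 if that number is not almost surely constant). *)
Definition as_root_count (L : {fset int}) (F : T -> int -> R[i]) : nat :=
  xget 0%N [set N | {ae P, forall w, root_count L (F w) = N}].

Definition prob_root_real (L : {fset int}) (F : T -> int -> R[i]) : \bar R :=
  (expected_real_roots L F * ((as_root_count L F)%:R^-1)%:E)%E.

End RandomLaurent.

(* Main.v *)
(* The real roots are counted by the sign changes of f on the grid of the
   m-th roots of unity, as m tends to infinity.

   The reproducing kernel of Trig(L) is the sum over l in L of cos(l(t - s));
   hence (f(s), f(t)) is a Gaussian pair with variances #L and a correlation
   depending only on t - s.  The standard Gaussian measure of the plane being
   rotation invariant, the measure of a double cone is additive in its angle,
   so a pair of correlation r has opposite signs with probability acos(r)/pi.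
   Summing over the grid, the expected number of sign changes is
   m acos(r_m)/pi, where r_m = 1 - (2 pi rms/m)^2/2 + o(m^-2), and this tends
   to 2 rms.

   By the intermediate value theorem the sign changes never outnumber the
   roots, and they eventually detect each of them when no root is double.
   Almost surely no root is double: at the grid point next to a double root f
   is O(m^-2), and the probability that this happens at one of the m grid points
   is O(1/m).  Fatou's lemma then gives the remaining inequality.

   For the number of complex roots it suffices that the two extreme
   coefficients, which are nontrivial Gaussian linear forms, almost surely do
   not vanish. *)
Require Import Defs.
From HB Require Import structures.
From mathcomp Require Import all_boot all_order all_algebra finmap complex.
From mathcomp Require Import all_classical all_reals all_analysis.
From mathcomp Require Import measurable_realfun ring lra zify.

Set Implicit Arguments.
Unset Strict Implicit.
Unset Printing Implicit Defensive.

Import Order.TTheory GRing.Theory Num.Theory.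
Import numFieldNormedType.Exports.

Local Open Scope classical_set_scope.
Local Open Scope ring_scope.


(** * Rotation invariance of the plane Gaussian measure *)

(** The law of (f(s), f(t)) must be extracted from the independence of standard normal coordinates
    in an arbitrary orthonormal basis. The coordinates are added one at a time: the pair is kept as
    the image of two independent standard normals under a lower triangular matrix, and each new
    variable is absorbed by two plane rotations, so that only rotation invariance in dimension two
    is ever used. What remains of u and v is their Gram matrix, which the kernel makes independent
    of the basis.

    Sign changes are counted in two ways. Strict ones produce distinct roots for every sample, which
    gives the lower bound; weak ones, where a vanishing end counts, also see roots lying on the grid
    and give the upper bound. Both have the same expectation, since f almost surely does not vanish
    at a given grid point.

    The bound on the second derivative that controls f near a double root depends on the sample; the
    exceptional event is therefore a union over integer bounds, each member of which is null. *)

Section GaussianPlane.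
Context {R : realType}.
Local Notation mR := (measurableTypeR R).
Local Notation mRR := (mR * mR)%type.
Local Notation mu := (@lebesgue_measure R).
Local Notation gam := (@normal_prob R 0 1).
Local Open Scope ereal_scope.

Lemma lebesgue_measureD (c : R) (A : set mR) : measurable A ->
  mu ((fun x : mR => (x + c)%R : mR) @^-1` A) = mu A.
Proof.
move=> mA.
have mf : measurable_fun [set: mR] (fun x : mR => (x + c)%R : mR).
  exact: measurable_funD.
pose f : {mfun mR >-> mR} := HB.pack_for {mfun mR >-> mR} (fun x : mR => (x + c)%R : mR)
  (isMeasurableFun.Build _ _ _ _ _ mf).
apply/esym/(@lebesgue_measure_unique R (pushforward mu f)) => //= _ [[a b]] _ <-.
rewrite /pushforward.
rewrite (_ : _ @^-1` _ = `](a - c)%R, (b - c)%R]%classic); last first.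
  by apply/seteqP; split=> x /=; rewrite !in_itv/= ltrBlDr lerBrDr.
rewrite !lebesgue_measure_itv/= !lte_fin ltrD2r -!EFinB.
by case: ifP => // _; congr EFin; ring.
Qed.

(** Gives access to horizontal slices: [lebesgue2_shear1] moves the first coordinate, so the product
    has to be integrated in the other order. *)
Lemma product_lebesgue2 (A : set (mRR)) : measurable A ->
  (mu \x mu) A = (mu \x^ mu) A.
Proof.
move=> mA.
apply: (product_measure_unique (m1 := mu) (m2 := mu) (m' := (mu \x^ mu))) => //=.
move=> B C mB mC.
by rewrite product_measure2E.
Qed.

Lemma measurable_shear1 (a : R) : measurable_fun [set: mRR]
  (fun z : mRR => ((z.1 + a * z.2)%R, z.2) : mRR).
Proof.
apply: measurable_fun_pair => //=; apply: measurable_funD => //.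
by apply: measurable_funM => //; exact: measurable_snd.
Qed.

Lemma measurable_shear2 (a : R) : measurable_fun [set: mRR]
  (fun z : mRR => (z.1, (z.2 + a * z.1)%R) : mRR).
Proof.
apply: measurable_fun_pair => //=; apply: measurable_funD => //.
by apply: measurable_funM => //; exact: measurable_fst.
Qed.

(** On the slice of height y the shear is the translation by a * y, which preserves the length of
    the slice. *)
Lemma lebesgue2_shear1 (a : R) (A : set (mRR)) : measurable A ->
  (mu \x mu) ((fun z : mRR => ((z.1 + a * z.2)%R, z.2)) @^-1` A) =
  (mu \x mu) A.
Proof.
move=> mA; rewrite !product_lebesgue2//; last first.
  by rewrite -[X in measurable X]setTI; exact: measurable_shear1.
apply: eq_integral => y _ /=.
rewrite -(@lebesgue_measureD (a * y)%R (ysection A y)); last first.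
  exact: measurable_ysection.
by congr (mu _); apply/seteqP; split => x; rewrite /ysection/= !inE.
Qed.

Lemma lebesgue2_shear2 (a : R) (A : set (mRR)) : measurable A ->
  (mu \x mu) ((fun z : mRR => (z.1, (z.2 + a * z.1)%R)) @^-1` A) =
  (mu \x mu) A.
Proof.
move=> mA; apply: eq_integral => x _ /=.
rewrite -(@lebesgue_measureD (a * x)%R (xsection A x)); last first.
  exact: measurable_xsection.
by congr (mu _); apply/seteqP; split => y; rewrite /xsection/= !inE.
Qed.

Lemma ge0_integral_lebesgue2_comp (T : mRR -> mRR)
    (f : mRR -> \bar R) :
  measurable_fun [set: mRR] T ->
  (forall A, measurable A -> (mu \x mu) (T @^-1` A) = (mu \x mu) A) ->
  measurable_fun [set: mRR] f -> (forall z, 0 <= f z) ->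
  \int[mu \x mu]_z f (T z) = \int[mu \x mu]_z f z.
Proof.
move=> mT TE mf f0.
pose T' : {mfun mRR >-> mRR} := HB.pack_for {mfun mRR >-> mRR} T
  (isMeasurableFun.Build _ _ _ _ _ mT).
transitivity (\int[pushforward (mu \x mu) T']_z f z).
  by rewrite ge0_integral_pushforward.
by apply: eq_measure_integral => A mA _; exact: TE.
Qed.

(* A rotation of angle other than pi is a product of three shears. *)
Lemma ge0_integral_lebesgue2_rot (c s : R) (f : mRR -> \bar R) :
  (c ^+ 2 + s ^+ 2 = 1)%R -> (-1 < c)%R ->
  measurable_fun [set: mRR] f -> (forall z, 0 <= f z) ->
  \int[mu \x mu]_z f ((c * z.1 - s * z.2)%R, (s * z.1 + c * z.2)%R) =
  \int[mu \x mu]_z f z.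
Proof.
(* If c and s are the cosine and sine of an angle, t is minus the tangent of its half. The rotation
   is the horizontal shear by t, then the vertical one by s, then the horizontal one by t. *)
move=> cs c1 mf f0; pose t := (- (s / (1 + c)))%R.
have c1_neq0 : (1 + c != 0)%R by rewrite gt_eqF//; lra.
have t1 : (t * (1 + c) = - s)%R by rewrite /t mulNr divfK.
have ts : (t * s = c - 1)%R.
  apply: (mulIf c1_neq0); rewrite mulrAC t1 mulNr -expr2.
  rewrite (_ : s ^+ 2 = 1 - c ^+ 2)%R; last by rewrite -cs addrAC subrr add0r.
  by ring.
pose S1 := fun z : mRR => ((z.1 + t * z.2)%R, z.2) : mRR.
pose S2 := fun z : mRR => (z.1, (z.2 + s * z.1)%R) : mRR.
have mS1 : measurable_fun [set: mRR] S1 := @measurable_shear1 t.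
have mS2 : measurable_fun [set: mRR] S2 := @measurable_shear2 s.
transitivity (\int[mu \x mu]_z f (S1 (S2 (S1 z)))).
  apply: eq_integral => -[x y] _; rewrite /S1 /S2/=; congr f; congr pair.
    transitivity ((1 + t * s) * x + t * (1 + (1 + t * s)) * y)%R; last by ring.
    rewrite ts (_ : 1 + (c - 1) = c)%R; last by ring.
    by rewrite t1; ring.
  transitivity (s * x + (1 + t * s) * y)%R; last by ring.
  by rewrite ts; ring.
rewrite (@ge0_integral_lebesgue2_comp S1 (fun z => f (S1 (S2 z))))//; first last.
  by apply: measurableT_comp => //; exact: measurableT_comp.
  by move=> A mA; exact: lebesgue2_shear1.
rewrite (@ge0_integral_lebesgue2_comp S2 (fun z => f (S1 z)))//; first last.
  exact: measurableT_comp.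
  by move=> A mA; exact: lebesgue2_shear2.
by rewrite (@ge0_integral_lebesgue2_comp S1 f)// => A mA; exact: lebesgue2_shear1.
Qed.

(** The abstract Radon-Nikodym derivative and [normal_pdf] have the same integral over every
    measurable set, hence agree almost everywhere. *)
Lemma ge0_integral_normal_prob (m s : R) (f : mR -> \bar R) :
  measurable_fun [set: mR] f -> (forall x, 0 <= f x) ->
  \int[normal_prob m s]_x f x = \int[mu]_x (f x * (normal_pdf m s x)%:E).
Proof.
move=> mf f0.
pose nu : {finite_measure set mR -> \bar R} := normal_prob m s.
have numu : nu `<< mu by exact: normal_prob_dominates.
rewrite -(@Radon_Nikodym_SigmaFinite.change_of_variables _ _ _ nu mu numu)//.
apply: ae_eq_integral => //.
- apply: emeasurable_funM => //; apply: (measurable_int mu).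
  exact: Radon_Nikodym_SigmaFinite.f_integrable.
- apply: emeasurable_funM => //; apply/measurable_EFinP.
  exact: measurable_normal_pdf.
- apply: ae_eqe_mul2l => /=; apply: integral_ae_eq => //=.
  + exact: Radon_Nikodym_SigmaFinite.f_integrable.
  + by apply/measurable_EFinP; exact: measurable_normal_pdf.
  + by move=> E _ mE; rewrite -Radon_Nikodym_SigmaFinite.f_integral.
Qed.


Lemma ge0_integral_normal2 (f : mRR -> \bar R) :
  measurable_fun [set: mRR] f -> (forall z, 0 <= f z) ->
  \int[gam \x gam]_z f z =
  \int[mu \x mu]_z (f z * (normal_pdf 0 1 z.1 * normal_pdf 0 1 z.2)%:E).
Proof.
move=> mf f0.
have mpdf : measurable_fun [set: mR] (normal_pdf (R := R) 0 1).
  exact: measurable_normal_pdf.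
have mpdf2 : measurable_fun [set: mRR]
    (fun z : mRR => (normal_pdf 0 1 z.1 * normal_pdf 0 1 z.2)%:E).
  apply/measurable_EFinP; apply: measurable_funM.
    by apply: measurableT_comp => //; exact: measurable_fst.
  by apply: measurableT_comp => //; exact: measurable_snd.
rewrite (fubini_tonelli1 f)//.
have mg : measurable_fun [set: mRR] (fun z : mRR =>
    f z * (normal_pdf 0 1 z.1 * normal_pdf 0 1 z.2)%:E).
  exact: emeasurable_funM.
rewrite (fubini_tonelli1 (fun z : mRR => f z * _))//; last first.
  by move=> z; rewrite mule_ge0// lee_fin mulr_ge0// normal_pdf_ge0.
rewrite ge0_integral_normal_prob//; last 2 first.
- exact: (measurable_fun_fubini_tonelli_F f).
- by move=> x; apply: integral_ge0.
apply: eq_integral => x _; rewrite /fubini_F ge0_integral_normal_prob//; last first.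
  exact: measurable_fun_pair2.
rewrite -ge0_integralZr//.
- by apply: eq_integral => y _ /=; rewrite -muleA -EFinM (mulrC (normal_pdf 0 1 x)).
- apply: emeasurable_funM; first exact: measurable_fun_pair2.
  exact/measurable_EFinP.
- by move=> y _; rewrite mule_ge0// lee_fin normal_pdf_ge0.
- by rewrite lee_fin normal_pdf_ge0.
Qed.

Lemma measurable_rotation (c s : R) : measurable_fun [set: mRR]
  (fun z : mRR => ((c * z.1 - s * z.2)%R, (s * z.1 + c * z.2)%R) : mRR).
Proof.
by apply: measurable_fun_pair => /=; [apply: measurable_funB|apply: measurable_funD];
  exact: measurable_funM.
Qed.

(** The product of the two densities depends only on x^2 + y^2, so it passes unchanged through the
    rotation, and the Lebesgue case applies. *)
Lemma ge0_integral_normal2_rot (c s : R) (f : mRR -> \bar R) :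
  (c ^+ 2 + s ^+ 2 = 1)%R -> (-1 < c)%R ->
  measurable_fun [set: mRR] f -> (forall z, 0 <= f z) ->
  \int[gam \x gam]_z f ((c * z.1 - s * z.2)%R, (s * z.1 + c * z.2)%R) =
  \int[gam \x gam]_z f z.
Proof.
move=> cs c1 mf f0.
have mpdf : measurable_fun [set: mR] (normal_pdf (R := R) 0 1).
  exact: measurable_normal_pdf.
pose g (z : mRR) : \bar R := f z * (normal_pdf 0 1 z.1 * normal_pdf 0 1 z.2)%:E.
have mg : measurable_fun [set: mRR] g.
  apply: emeasurable_funM => //; apply/measurable_EFinP; apply: measurable_funM.
    by apply: measurableT_comp => //; exact: measurable_fst.
  by apply: measurableT_comp => //; exact: measurable_snd.
have g0 z : 0 <= g z.
  by rewrite /g mule_ge0// lee_fin mulr_ge0// normal_pdf_ge0.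
rewrite [RHS]ge0_integral_normal2// -(ge0_integral_lebesgue2_rot cs c1 mg g0).
have mfrot := measurableT_comp mf (measurable_rotation c s).
rewrite (ge0_integral_normal2 mfrot); last by move=> z; exact: f0.
apply: eq_integral => -[x y] _; rewrite /g/=; congr (_ * _%:E).
rewrite !normal_pdfE ?oner_neq0// /normal_fun !subr0 !expr1n.
rewrite -!mulrA; congr (_ * _)%R; rewrite !mulrA ![(expR _ * _)%R]mulrC -!mulrA.
congr (_ * _)%R; rewrite -!expRD; congr expR.
rewrite -!mulrDl; congr (_ / _)%R.
transitivity (- ((c ^+ 2 + s ^+ 2) * (x ^+ 2 + y ^+ 2)))%R; last by ring.
by rewrite cs; ring.
Qed.

(** Iterated form, suited to rotating two variables while a third one is held fixed. *)
Lemma ge0_iterated_normal_rot (c s : R) (f : mRR -> \bar R) :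
  (c ^+ 2 + s ^+ 2 = 1)%R -> (-1 < c)%R ->
  measurable_fun [set: mRR] f -> (forall z, 0 <= f z) ->
  \int[gam]_x \int[gam]_y f ((c * x - s * y)%R, (s * x + c * y)%R) =
  \int[gam]_x \int[gam]_y f (x, y).
Proof.
move=> cs c1 mf f0; rewrite -(fubini_tonelli1 f)//.
rewrite -(ge0_integral_normal2_rot cs c1 mf f0).
have mfrot := measurableT_comp mf (measurable_rotation c s).
by rewrite (fubini_tonelli1 _ mfrot)// => z; exact: f0.
Qed.

End GaussianPlane.

(** * Joint law of two Gaussian linear combinations *)

Section GaussianLinear.
Context {R : realType}.
Local Notation mR := (measurableTypeR R).
Local Notation mRR := (mR * mR)%type.
Local Notation gam := (@normal_prob R 0 1).
Local Open Scope ereal_scope.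

(** The rotation that carries the row (a, p) onto (r, 0), r being its length. As a is nonnegative so
    is the cosine a / r, which keeps clear of the half turn, not covered by the shear
    decomposition. *)
Lemma collapsing_rotation (a p : R) : (0 <= a)%R -> exists c s : R,
  [/\ (c ^+ 2 + s ^+ 2 = 1)%R, (-1 < c)%R,
      (0 <= a * c + p * s)%R & (p * c - a * s = 0)%R].
Proof.
move=> a0; have [/eqP|r0] := eqVneq (a ^+ 2 + p ^+ 2)%R 0%R.
  rewrite paddr_eq0 ?sqr_ge0// !sqrf_eq0 => /andP[/eqP -> /eqP ->].
  by exists 1%R, 0%R; split; rewrite ?expr1n ?expr0n ?mul0r ?addr0 ?subr0//; lra.
pose r := Num.sqrt (a ^+ 2 + p ^+ 2).
have rge0 : (0 <= a ^+ 2 + p ^+ 2)%R by rewrite addr_ge0 ?sqr_ge0.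
have rgt0 : (0 < r)%R by rewrite sqrtr_gt0 lt_neqAle eq_sym r0.
have rneq0 : (r != 0)%R by rewrite gt_eqF.
have rE : (r ^+ 2 = a ^+ 2 + p ^+ 2)%R by rewrite sqr_sqrtr.
exists (a / r)%R, (p / r)%R; split.
- by rewrite !expr_div_n -mulrDl -rE divff// expf_neq0.
- by rewrite (@lt_le_trans _ _ 0%R) ?ltrN10// divr_ge0// ltW.
- by rewrite !mulrA -mulrDl divr_ge0 ?(ltW rgt0)// -!expr2.
- by rewrite !mulrA (mulrC p) subrr.
Qed.

(* The third variable x is absorbed by two plane rotations, of (z.1, x) and then
   of (z.2, x); the new matrix is again lower triangular and has the Gram matrix
   of the enlarged one. *)
Lemma givens_step (a b c p q : R) : (0 <= a)%R -> (0 <= c)%R ->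
  exists a' b' c' : R,
  [/\ (0 <= a')%R, (0 <= c')%R,
      [/\ (a' ^+ 2 = a ^+ 2 + p ^+ 2)%R,
      (a' * b' = a * b + p * q)%R &
      (b' ^+ 2 + c' ^+ 2 = b ^+ 2 + c ^+ 2 + q ^+ 2)%R] &
      forall f : mRR -> \bar R, measurable_fun [set: mRR] f ->
        (forall z, 0 <= f z) ->
        \int[gam \x gam]_z \int[gam]_x
          f ((a * z.1 + p * x)%R, (b * z.1 + c * z.2 + q * x)%R) =
        \int[gam \x gam]_z f ((a' * z.1)%R, (b' * z.1 + c' * z.2)%R)].
Proof.
move=> a0 c0.
have [C [S [CS C1 a'0 ap0]]] := collapsing_rotation p a0.
pose q1 := (q * C - b * S)%R; pose b' := (b * C + q * S)%R.
have [D [T [DT D1 c'0 cq0]]] := collapsing_rotation q1 c0.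
pose a' := (a * C + p * S)%R; pose c' := (c * D + q1 * T)%R.
exists a', b', c'; split => //.
  (* Rotations preserve the Gram matrix of the rows. Inserting the factor C^2 + S^2 = 1 makes this a
     polynomial identity, up to the two entries annihilated by [ap0] and [cq0]. *)
  have -> : (b ^+ 2 + c ^+ 2 + q ^+ 2 =
      (b ^+ 2 + q ^+ 2) * (C ^+ 2 + S ^+ 2) + c ^+ 2)%R by rewrite CS; ring.
  have -> : (a ^+ 2 + p ^+ 2 = (a ^+ 2 + p ^+ 2) * (C ^+ 2 + S ^+ 2))%R.
    by rewrite CS; ring.
  have -> : (a * b + p * q = (a * b + p * q) * (C ^+ 2 + S ^+ 2))%R.
    by rewrite CS; ring.
  split.
  - transitivity (a' ^+ 2 + (p * C - a * S) ^+ 2)%R; last by rewrite /a'; ring.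
    by rewrite ap0; ring.
  - transitivity (a' * b' + (p * C - a * S) * q1)%R; last by rewrite /a' /b' /q1; ring.
    by rewrite ap0; ring.
  - transitivity (b' ^+ 2 + c' ^+ 2 + (q1 * D - c * T) ^+ 2)%R.
      by rewrite cq0; ring.
    transitivity (b' ^+ 2 + (c ^+ 2 + q1 ^+ 2) * (D ^+ 2 + T ^+ 2))%R.
      by rewrite /c'; ring.
    by rewrite DT /b' /q1; ring.
move=> f mf f0.
have msnd3 : measurable_fun [set: mRR * mR] (fun w : mRR * mR => w.2 : mR).
  exact: measurable_snd.
have mfst1 : measurable_fun [set: mRR * mR] (fun w : mRR * mR => w.1.1 : mR).
  by apply: measurableT_comp => //; exact: measurable_fst.
have mfst2 : measurable_fun [set: mRR * mR] (fun w : mRR * mR => w.1.2 : mR).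
  by apply: measurableT_comp => //; exact: measurable_snd.
have mlin (k1 k2 k3 l1 l2 l3 : R) : measurable_fun [set: mRR * mR]
    (fun w : mRR * mR => f ((k1 * w.1.1 + k2 * w.1.2 + k3 * w.2)%R,
                            (l1 * w.1.1 + l2 * w.1.2 + l3 * w.2)%R)).
  apply: (measurableT_comp mf); apply: measurable_fun_pair => /=;
  by do ?[apply: measurable_funD|apply: measurable_funM].
have mint (k1 k2 k3 l1 l2 l3 : R) : measurable_fun [set: mRR]
    (fun z : mRR => \int[gam]_x
      f ((k1 * z.1 + k2 * z.2 + k3 * x)%R, (l1 * z.1 + l2 * z.2 + l3 * x)%R)).
  exact: (measurable_fun_fubini_tonelli_F _ (mlin k1 k2 k3 l1 l2 l3)).
have int0 (k1 k2 k3 l1 l2 l3 : R) (z : mRR) : 0 <= \int[gam]_x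
      f ((k1 * z.1 + k2 * z.2 + k3 * x)%R, (l1 * z.1 + l2 * z.2 + l3 * x)%R).
  by apply: integral_ge0.
have tonelli_swap (k1 k2 k3 l1 l2 l3 : R) :
    \int[gam \x gam]_z \int[gam]_x
      f ((k1 * z.1 + k2 * z.2 + k3 * x)%R, (l1 * z.1 + l2 * z.2 + l3 * x)%R) =
    \int[gam]_y \int[gam]_z \int[gam]_x
      f ((k1 * z + k2 * y + k3 * x)%R, (l1 * z + l2 * y + l3 * x)%R).
  exact: (fubini_tonelli2 _ (mint k1 k2 k3 l1 l2 l3) (int0 k1 k2 k3 l1 l2 l3)).
(* The second variable is moved outermost, so that the two variables mixed by the rotation (C, S)
   are the inner ones. *)
transitivity (\int[gam]_y \int[gam]_z \int[gam]_x
    f ((a * z + 0 * y + p * x)%R, (b * z + c * y + q * x)%R)).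
  rewrite -tonelli_swap.
  by apply: eq_integral => z _; apply: eq_integral => x _; rewrite mul0r addr0.
transitivity (\int[gam]_y \int[gam]_z \int[gam]_x
    f ((a' * z + 0 * y + 0 * x)%R, (b' * z + c * y + q1 * x)%R)).
  apply: eq_integral => y _.
  pose g (w : mRR) :=
    f ((a * w.1 + 0 * y + p * w.2)%R, (b * w.1 + c * y + q * w.2)%R).
  have mg : measurable_fun [set: mRR] g.
    apply: (measurableT_comp mf); apply: measurable_fun_pair => /=;
    by do ?[apply: measurable_funD|apply: measurable_funM].
  transitivity (\int[gam]_x \int[gam]_y g (x, y)); first by [].
  rewrite -(ge0_iterated_normal_rot CS C1 mg); last by move=> ?; exact: f0.
  apply: eq_integral => z _; apply: eq_integral => x _; congr (f (_, _)) => /=.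
    transitivity ((a * C + p * S) * z + (p * C - a * S) * x)%R; first by ring.
    by rewrite ap0 /a'; ring.
  by rewrite /b' /q1; ring.
(* Now the first variable goes outermost: the rotation (D, T) mixes the second variable with x and
   clears the remaining coefficient [q1]. *)
rewrite -tonelli_swap fubini_tonelli1//.
transitivity (\int[gam]_z \int[gam]_y \int[gam]_x
    f ((a' * z + 0 * y + 0 * x)%R, (b' * z + c' * y + 0 * x)%R)).
  apply: eq_integral => z _ /=.
  pose g (w : mRR) :=
    f ((a' * z + 0 * w.1 + 0 * w.2)%R, (b' * z + c * w.1 + q1 * w.2)%R).
  have mg : measurable_fun [set: mRR] g.
    apply: (measurableT_comp mf); apply: measurable_fun_pair => /=;
    by do ?[apply: measurable_funD|apply: measurable_funM].
  transitivity (\int[gam]_x \int[gam]_y g (x, y)); first by [].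
  rewrite -(ge0_iterated_normal_rot DT D1 mg); last by move=> ?; exact: f0.
  apply: eq_integral => y _; apply: eq_integral => x _; congr (f (_, _)) => /=.
    by ring.
  transitivity (b' * z + (c * D + q1 * T) * y + (q1 * D - c * T) * x)%R; first by ring.
  by rewrite cq0 /c'; ring.
rewrite fubini_tonelli1; [| |by move=> ?; exact: f0]; last first.
  apply: (measurableT_comp mf); apply: measurable_fun_pair => /=;
  by do ?[apply: measurable_funD|apply: measurable_funM].
apply: eq_integral => z _; apply: eq_integral => y _ /=.
under eq_integral do rewrite !mul0r !addr0.
by rewrite integral_cst//= probability_setT mule1.
Qed.

End GaussianLinear.

Section JointLaw.
Local Open Scope ereal_scope.

(** Both sides are measures in W, the left one finite, and they agree on rectangles, a pi-system
    generating the product sigma-algebra. *)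
Lemma joint_law_rectangles (d d1 d2 : measure_display) (T : measurableType d)
    (T1 : measurableType d1) (T2 : measurableType d2) (R : realType)
    (P : probability T R) (nu1 : {measure set T1 -> \bar R}) (nu2 : probability T2 R)
    (S : T -> T1) (Y : T -> T2) (D : set T) :
  measurable_fun [set: T] S -> measurable_fun [set: T] Y -> measurable D ->
  (forall (E : set T1) (C : set T2), measurable E -> measurable C ->
    P (S @^-1` E `&` Y @^-1` C `&` D) = nu1 E * nu2 C * P D) ->
  forall W : set (T1 * T2), measurable W ->
    P ([set w | W (S w, Y w)] `&` D) = (nu1 \x nu2) W * P D.
Proof.
move=> mS mY mD H W mW.
have mSY : measurable_fun [set: T] (fun w => (S w, Y w)).
  exact: measurable_fun_pair.
have PD0 : (0 <= fine (P D))%R by rewrite fine_ge0// measure_ge0.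
pose m1 : {measure set (T1 * T2) -> \bar R} :=
  measure_function_pushforward__canonical__measure_function_Measure (mrestr P mD) mSY.
pose m2 : {measure set (T1 * T2) -> \bar R} := mscale (NngNum PD0) (nu1 \x nu2).
have PDE : (fine (P D))%:E = P D by rewrite fineK// fin_num_measure.
have : m1 W = m2 W.
  apply: (measure_unique [set A `*` B | A in @measurable _ T1 & B in @measurable _ T2]
            (fun=> setT)) => //.
  - exact: measurable_prod_measurableType.
  - move=> _ _ [A mA [B mB <-]] [A' mA' [B' mB' <-]].
    exists (A `&` A'); first exact: measurableI.
    by exists (B `&` B'); [exact: measurableI|rewrite setXI].
  - by move=> _; exists setT => //; exists setT => //; rewrite setXTT.
  - by rewrite bigcup_const.
  - move=> _ [A mA [B mB <-]].
    rewrite /m1 /m2/= /pushforward /mrestr /mscale/=. rewrite PDE product_measure1E//.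
    by rewrite muleC -H.
  - move=> _; rewrite /m1/= /pushforward /mrestr/= preimage_setT setTI.
    by rewrite (le_lt_trans (probability_le1 P mD))// ltry.
by rewrite /m1 /m2/= /pushforward /mrestr /mscale/= PDE muleC.
Qed.

Context {R : realType}.
Local Notation mR := (measurableTypeR R).
Local Notation mRR := (mR * mR)%type.
Local Notation gam := (@normal_prob R 0 1).

(** The matrix with rows (a, 0) and (b, c) is a Cholesky factor of the Gram matrix of u and v. In
    the induction, independence turns the next variable into one more Gaussian factor, which
    [givens_step] absorbs. *)
Lemma gaussian_pair_law (d : measure_display) (T : measurableType d)
    (P : probability T R) (n : nat) (X : 'I_n -> {RV P >-> R})
    (indX : independent_RVs X) (stdX : forall i, standard_normal (X i))
    (u v : 'I_n -> R) :
  exists a b c : R, [/\ (0 <= a)%R, (0 <= c)%R,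
    [/\ (a ^+ 2 = \sum_i u i ^+ 2)%R, (a * b = \sum_i u i * v i)%R &
        (b ^+ 2 + c ^+ 2 = \sum_i v i ^+ 2)%R] &
    forall E : set mRR, measurable E ->
      P [set w | E (\sum_i u i * X i w, \sum_i v i * X i w)%R] =
      (gam \x gam) [set z | E (a * z.1, b * z.1 + c * z.2)%R]].
Proof.
pose J k : {set 'I_n} := [set i : 'I_n | (k <= i)%N]%SET.
pose D k (B : 'I_n -> set mR) := \bigcap_(i in [set` J k]) (X i @^-1` B i).
have mX i : measurable_fun [set: T] (X i : T -> mR).
  by have : measurable_fun [set: T] (X i); first exact: measurable_funPT.
have mXB i (C : set mR) : measurable C -> measurable (X i @^-1` C).
  by move=> mC; rewrite -[X in measurable X]setTI; exact: mX.
have mD k B : (forall i, measurable (B i)) -> measurable (D k B).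
  move=> mB; apply: fin_bigcap_measurable => [|i _]; last exact: mXB.
  exact: finite_finset.
pose U k w := (\sum_(i < n | (i < k)%N) u i * X i w)%R.
pose V k w := (\sum_(i < n | (i < k)%N) v i * X i w)%R.
have mS (k : nat) (x : 'I_n -> R) :
    measurable_fun [set: T] ((fun w => \sum_(i < n | (i < k)%N) x i * X i w)%R : T -> mR).
  rewrite (_ : (fun _ => _) = (fun w =>
    \sum_(i <- [seq i : 'I_n <- index_enum 'I_n | (i < k)%N]) x i * X i w)%R).
    apply: measurable_sum => i; exact: measurable_funM.
  by apply/funext => w; rewrite big_filter.
have mUV k : measurable_fun [set: T] (fun w => (U k w, V k w) : mRR).
  by apply: measurable_fun_pair; exact: mS.
(* The event D k B on the variables not yet summed carries the independence
   through the induction. *)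
suff H k : (k <= n)%N -> exists a b c : R, [/\ (0 <= a)%R, (0 <= c)%R,
    [/\ (a ^+ 2 = \sum_(i < n | (i < k)%N) u i ^+ 2)%R,
        (a * b = \sum_(i < n | (i < k)%N) u i * v i)%R &
        (b ^+ 2 + c ^+ 2 = \sum_(i < n | (i < k)%N) v i ^+ 2)%R] &
    forall (E : set mRR) B, measurable E -> (forall i, measurable (B i)) ->
      P ([set w | E (U k w, V k w)] `&` D k B) =
      (gam \x gam) [set z | E (a * z.1, b * z.1 + c * z.2)%R] * P (D k B)].
  have [a [b [c [a0 c0 [ha hb hc] h]]]] := H n (leqnn n).
  have ord_true (F : 'I_n -> R) : (\sum_(i < n | (i < n)%N) F i = \sum_i F i)%R.
    by apply: eq_bigl => i; rewrite ltn_ord.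
  exists a, b, c; split => //.
    split.
    - by rewrite ha; exact: ord_true.
    - by rewrite hb; exact: ord_true.
    - by rewrite hc; exact: ord_true.
  move=> E mE; have := h E (fun=> setT) mE (fun=> measurableT).
  have -> : D n (fun=> setT) = setT by apply: bigcapT => i; rewrite preimage_setT.
  rewrite setIT probability_setT mule1 => <-; congr (P _).
  by apply/funext => w; rewrite /U /V; congr (E (_, _)); apply/esym; exact: ord_true.
have gamT : (gam \x gam) setT = 1.
  rewrite (_ : setT = setT `*` setT); last by rewrite setXTT.
  by rewrite product_measure1E//= !probability_setT mule1.
elim: k => [_|k IH kn].
  exists 0%R, 0%R, 0%R; split=> //.
    by split; rewrite ?expr0n/= ?mul0r ?addr0 big_pred0.
  move=> E B mE mB.
  rewrite (_ : [set z : mRR | _] = [set _ | E (0, 0)%R]); last first.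
    by apply/funext => z/=; rewrite !mul0r addr0.
  rewrite (_ : [set w : T | _] = [set _ | E (0, 0)%R]); last first.
    by apply/funext => w/=; rewrite /U /V !big_pred0.
  have [E0|E0] := pselect (E (0, 0)%R).
    rewrite (_ : [set _ | _] = setT); last by apply/seteqP; split.
    rewrite (_ : [set _ | _] = setT); last by apply/seteqP; split.
    by rewrite setTI gamT mul1e.
  rewrite (_ : [set _ | _] = set0); last by apply/seteqP; split.
  rewrite (_ : [set _ | _] = set0); last by apply/seteqP; split.
  by rewrite set0I !measure0 mul0e.
have [a [b [c [a0 c0 [ha hb hc] h]]]] := IH (ltnW kn).
pose kk : 'I_n := Ordinal kn.
have [a' [b' [c' [a'0 c'0 [ha' hb' hc'] h']]]] := givens_step b (u kk) (v kk) a0 c0.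
have sumS (F : 'I_n -> R) : (\sum_(i < n | (i < k.+1)%N) F i =
    \sum_(i < n | (i < k)%N) F i + F kk)%R.
  rewrite (bigD1 kk)/= ?ltnSn// addrC; congr (_ + _)%R; apply: eq_bigl => i.
  by rewrite ltnS ltn_neqAle andbC.
exists a', b', c'; split => //.
  split.
  - by rewrite ha' ha; exact/esym/sumS.
  - by rewrite hb' hb; exact/esym/sumS.
  - by rewrite hc' hc; exact/esym/sumS.
move=> E B mE mB.
have JkE : J k = (kk |: J k.+1)%SET.
  by apply/setP => i; rewrite !inE leq_eqVlt eq_sym.
have kkJ : kk \notin J k.+1 by rewrite inE ltnn.
have gE (C : set mR) (mC : measurable C) : P (X kk @^-1` C) = gam C.
  by rewrite -(stdX kk C mC).
(* Constraining the variable of index k to C turns [D k.+1 B] into an event of the form [D k], to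
   which the induction hypothesis applies; this yields the rectangle formula. *)
have DkE (C : set mR) : measurable C ->
    let B' i := if i == kk then C else B i in
    (forall i, measurable (B' i)) /\
    D k B' = X kk @^-1` C `&` D k.+1 B /\ P (D k B') = gam C * P (D k.+1 B).
  move=> mC B'; have mB' i : measurable (B' i) by rewrite /B'; case: ifP.
  split => //; split.
    apply/seteqP; split => w.
      move=> Dw; split; first by have := Dw kk; rewrite /= inE leqnn /B' eqxx; apply.
      move=> i /=; rewrite inE => ki; have := Dw i; rewrite /= inE (ltnW ki) /B'.
      by case: eqP => [ik|_]; [rewrite ik ltnn in ki|apply].
    move=> [Cw Dw] i /=; rewrite inE leq_eqVlt /B' => /orP[/eqP ki|ki].
      by have -> : i = kk; [apply/val_inj|rewrite eqxx].
    case: eqP => [ik|_]; first by rewrite ik ltnn in ki.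
    by apply: Dw; rewrite /= inE.
  rewrite /D indX// indX// JkE big_setU1//= /B' eqxx gE//; congr (_ * _).
  by apply: eq_bigr => i iJ; case: eqP => // ik; rewrite ik (negbTE kkJ) in iJ.
have mL : measurable_fun [set: mRR]
    (fun z : mRR => (a * z.1, b * z.1 + c * z.2)%R : mRR).
  by apply: measurable_fun_pair => /=; do ?[apply: measurable_funD|apply: measurable_funM].
pose nu : {measure set mRR -> \bar R} :=
  measure_function_pushforward__canonical__measure_function_Measure (gam \x gam) mL.
pose W : set (mRR * mR) := [set w | E (w.1.1 + u kk * w.2, w.1.2 + v kk * w.2)%R].
have mW : measurable W.
  suff mg : measurable_fun [set: mRR * mR]
      (fun w : mRR * mR => (w.1.1 + u kk * w.2, w.1.2 + v kk * w.2)%R : mRR).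
    by rewrite -[X in measurable X]setTI; exact: mg.
  have m1 : measurable_fun [set: mRR * mR] (fun w : mRR * mR => w.1.1 : mR).
    by apply: measurableT_comp => //; exact: measurable_fst.
  have m2 : measurable_fun [set: mRR * mR] (fun w : mRR * mR => w.1.2 : mR).
    by apply: measurableT_comp => //; exact: measurable_snd.
  have m3 : measurable_fun [set: mRR * mR] (fun w : mRR * mR => w.2 : mR).
    exact: measurable_snd.
  by apply: measurable_fun_pair => /=; apply: measurable_funD => //; exact: measurable_funM.
transitivity (P ([set w | W ((U k w, V k w), X kk w)] `&` D k.+1 B)).
  by congr (P (_ `&` _)); apply/funext => w; rewrite /W /U /V/=; congr (E (_, _)); exact: sumS.
rewrite (@joint_law_rectangles _ _ _ _ _ _ _ P nu gam)//; last first.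
- move=> F C mF mC; have [mB' [DB' PB']] := DkE C mC.
  transitivity (P ([set w | F (U k w, V k w)] `&` D k (fun i => if i == kk then C else B i))).
    by rewrite DB' setIA.
  by rewrite h// PB' muleA.
- exact: mD.
congr (_ * _).
have mE1 : measurable_fun [set: mRR] (fun z : mRR => (\1_E z)%:E : \bar R).
  by apply/measurable_EFinP; exact: measurable_indic.
have L'm : measurable [set z : mRR | E (a' * z.1, b' * z.1 + c' * z.2)%R].
  suff mL' : measurable_fun [set: mRR]
      (fun z : mRR => (a' * z.1, b' * z.1 + c' * z.2)%R : mRR).
    by rewrite -[X in measurable X]setTI; exact: mL'.
  by apply: measurable_fun_pair => /=; do ?[apply: measurable_funD|apply: measurable_funM].
(* Unfolding the product measure into slices gives the left side of the identity of [givens_step],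
   with f the indicator of E. *)
transitivity (\int[nu]_s gam (xsection W s)) => //.
rewrite ge0_integral_pushforward//; last exact: (measurable_fun_xsection gam).
transitivity (\int[gam \x gam]_z (\1_E (a' * z.1, b' * z.1 + c' * z.2)%R)%:E); last first.
  by set S' := [set z | _]; rewrite -(setIT S') -integral_indic//.
rewrite -(h' (fun z => (\1_E z)%:E) mE1); last by move=> z; rewrite lee_fin.
apply: eq_integral => z _ /=.
set S' := xsection _ _; rewrite -(setIT S') -integral_indic//; last exact: measurable_xsection.
apply: eq_integral => x _; rewrite !indicE /=; congr (_%:R%:E); congr nat_of_bool.
by apply/idP/idP => /set_mem h1; apply/mem_set; move: h1; rewrite /S' /xsection/= ?inE.
Qed.

End JointLaw.

(** * Sign changes of a Gaussian pair *)

Section PlaneSets.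
Context {R : realType}.
Local Notation mR := (measurableTypeR R).
Local Notation mRR := (mR * mR)%type.
Local Notation gam := (@normal_prob R 0 1).
Local Notation gam2 := (gam \x gam)%E.

Lemma measurable_mul_lt0 d (T : measurableType d) (f g : T -> mR) :
  measurable_fun [set: T] f -> measurable_fun [set: T] g ->
  measurable [set w | f w * g w < 0].
Proof.
move=> mf mg; rewrite -[X in measurable X]setTI.
rewrite (_ : [set w | _] = (fun w => f w * g w : mR) @^-1` `]-oo, 0[%classic).
  by apply: measurable_funM.
by apply/seteqP; split => w; rewrite /= in_itv.
Qed.

Lemma measurable_mul_le0 d (T : measurableType d) (f g : T -> mR) :
  measurable_fun [set: T] f -> measurable_fun [set: T] g ->
  measurable [set w | f w * g w <= 0].
Proof.
move=> mf mg; rewrite -[X in measurable X]setTI.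
rewrite (_ : [set w | _] = (fun w => f w * g w : mR) @^-1` `]-oo, 0]%classic).
  by apply: measurable_funM.
by apply/seteqP; split => w; rewrite /= in_itv.
Qed.

Lemma normal2_rot (c s : R) (E : set mRR) :
  c ^+ 2 + s ^+ 2 = 1 -> -1 < c -> measurable E ->
  gam2 [set z : mRR | E (c * z.1 - s * z.2, s * z.1 + c * z.2)] = gam2 E.
Proof.
move=> cs c1 mE.
have mS : measurable [set z : mRR | E (c * z.1 - s * z.2, s * z.1 + c * z.2)].
  by rewrite -[X in measurable X]setTI; exact: measurable_rotation.
rewrite -[E in RHS]setIT -integral_indic//; set S := [set z | _].
rewrite -(setIT S) -integral_indic//.
have mf : measurable_fun [set: mRR] (fun z => (\1_E z)%:E : \bar R).
  exact/measurable_EFinP/measurable_indic.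
by rewrite -(ge0_integral_normal2_rot cs c1 mf).
Qed.

Lemma normal2_setX (A B : set mR) : measurable A -> measurable B ->
  gam2 (A `*` B) = (gam A * gam B)%E.
Proof. by move=> mA mB; rewrite product_measure1E. Qed.

Lemma normal2_setT : gam2 [set: mRR] = 1%E.
Proof.
rewrite (_ : setT = setT `*` setT); last by rewrite setXTT.
by rewrite product_measure1E//= !probability_setT mule1.
Qed.

Lemma normal_prob_set1 (x : R) : gam [set x] = 0%E.
Proof.
have : gam `<< (@lebesgue_measure R) by exact: normal_prob_dominates.
move/null_content_dominatesP; apply => //; exact: lebesgue_measure_set1.
Qed.

End PlaneSets.

Section RotationInvariant.
Context {R : realType}.
Local Notation mR := (measurableTypeR R).
Local Notation mRR := (mR * mR)%type.
Variable m : {measure set mRR -> \bar R}.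
Hypothesis mT : m setT = 1%E.
Hypothesis m_axis : m ([set 0] `*` setT) = 0%E.
Hypothesis m_rot : forall (c s : R) (E : set mRR),
  c ^+ 2 + s ^+ 2 = 1 -> -1 < c -> measurable E ->
  m [set z : mRR | E (c * z.1 - s * z.2, s * z.1 + c * z.2)] = m E.

Let proj (t : R) (z : mRR) : mR := cos t * z.1 + sin t * z.2.

Let measurable_proj t : measurable_fun [set: mRR] (proj t).
Proof. by apply: measurable_funD; exact: measurable_funM. Qed.

Let measurable_proj0 t : measurable [set z | proj t z = 0].
Proof.
rewrite -[X in measurable X]setTI.
rewrite (_ : [set z | _] = proj t @^-1` [set 0]) //.
exact: measurable_proj.
Qed.

(** The line is a rotated copy of the vertical axis. The half turn is excluded from [m_rot], but at
    t = pi the line is the one of t = 0. *)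
Let proj_null t : 0 <= t <= pi -> m [set z | proj t z = 0] = 0%E.
Proof.
move=> /andP[t0 tpi].
wlog tltpi : t t0 tpi / t < pi => [hw|].
  move: tpi; rewrite le_eqVlt => /orP[/eqP ->|tpi]; last exact: hw (ltW _) _.
  rewrite -(hw 0 (lexx 0) (pi_ge0 R) (pi_gt0 R)); congr (m _); apply/funext => z.
  rewrite /proj/= cospi sinpi cos0 sin0 !mul0r !addr0 mulN1r mul1r.
  by apply/propext; split => [/eqP|->]; [rewrite oppr_eq0 => /eqP|rewrite oppr0].
have cs : cos t ^+ 2 + (- sin t) ^+ 2 = 1 by rewrite sqrrN cos2Dsin2.
have c1 : -1 < cos t by rewrite -cospi ltr_cos// in_itv/= ?pi_ge0 ?lexx ?t0 ?tpi.
have mE : measurable ([set (0 : R)] `*` [set: mR]) by exact: measurableX.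
have := m_rot cs c1 mE; rewrite m_axis => <-.
by congr (m _); apply/funext => z; rewrite /proj/= mulNr opprK; apply/propext; split => // -[].
Qed.

(** The double cone between the lines orthogonal to the directions of angles a and b. *)
Let cone a b := [set z | proj a z * proj b z < 0].

Let measurable_cone a b : measurable (cone a b).
Proof. exact: measurable_mul_lt0. Qed.

Let q t := fine (m (cone 0 t)).

Let m_fin (A : set mRR) : measurable A -> m A \is a fin_num.
Proof.
move=> mA; rewrite ge0_fin_numE ?measure_ge0// (@le_lt_trans _ _ 1%E) ?ltry//.
by rewrite -mT le_measure// inE.
Qed.

Let cone_shift a b : 0 <= a < pi -> m (cone a (a + b)) = m (cone 0 b).
Proof.
move=> /andP[a0 api].
have cs : cos a ^+ 2 + (- sin a) ^+ 2 = 1 by rewrite sqrrN cos2Dsin2.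
have c1 : -1 < cos a by rewrite -cospi ltr_cos// in_itv/= ?pi_ge0 ?lexx ?a0 ?ltW.
rewrite -(m_rot cs c1 (measurable_cone 0 b)); congr (m _).
apply/funext => z; rewrite /cone /proj/= cos0 sin0 cosD sinD.
by congr is_true; congr (_ < _); ring.
Qed.

Let null_eq (A B N : set mRR) : measurable A -> measurable B -> measurable N ->
  m N = 0%E -> A `<=` B `|` N -> B `<=` A `|` N -> m A = m B.
Proof.
have le (C D : set mRR) : measurable C -> measurable D -> measurable N ->
    m N = 0%E -> C `<=` D `|` N -> (m C <= m D)%E.
  move=> mC mD mN N0 CD; apply: (@le_trans _ _ (m (D `|` N))).
    by apply: le_measure => //; rewrite inE//; exact: measurableU.
  by apply: le_trans (measureU2 _ mD mN) _; rewrite /= N0 adde0.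
move=> mA mB mN N0 AB BA.
by apply/le_anti/andP; split; [exact: (le A B)|exact: (le B A)].
Qed.

(** By [rel], the middle component times sin (a + b) >= 0 is a combination of the outer ones with
    positive coefficients when a and b are positive. Hence it cannot be opposite in sign to both,
    which makes the two small cones disjoint; and if the outer signs agree it opposes neither, so
    that the small cones fill the large one up to three null lines. *)
Let cone_add a b : 0 <= a -> 0 <= b -> a + b <= pi -> q (a + b) = q a + q b.
Proof.
rewrite le_eqVlt => /orP[/eqP <- _ _|a0].
  rewrite add0r /q [X in fine (m X) + _](_ : _ = set0) ?measure0 ?add0r//.
  by apply/seteqP; split => // z; rewrite /cone/= -expr2 ltNge sqr_ge0.
rewrite le_eqVlt => /orP[/eqP <- _|b0 abpi].
  rewrite addr0 /q [X in _ + fine (m X)](_ : _ = set0) ?measure0 ?addr0//.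
  by apply/seteqP; split => // z; rewrite /cone/= -expr2 ltNge sqr_ge0.
have api : a < pi by rewrite (lt_le_trans _ abpi)// ltrDl.
have bpi : b < pi by rewrite (lt_le_trans _ abpi)// ltrDr.
have apos : 0 < sin a by rewrite sin_gt0_pi// a0.
have bpos : 0 < sin b by rewrite sin_gt0_pi// b0.
have abpos : 0 <= sin (a + b) by rewrite sin_ge0_pi// abpi addr_ge0 ?ltW.
have rel z : sin (a + b) * proj a z = sin b * proj 0 z + sin a * proj (a + b) z.
  rewrite /proj cos0 sin0 sinD cosD.
  transitivity ((cos a ^+ 2 + sin a ^+ 2) * (sin b * z.1) +
    (sin a * cos b * cos a - sin b * sin a ^+ 2) * z.1 +
    (sin a * cos b + cos a * sin b) * (sin a * z.2)).
    ring.
  by rewrite cos2Dsin2; ring.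
have -> : q a + q b = fine (m (cone 0 a `|` cone a (a + b))).
  rewrite measureU//.
  - rewrite fineD ?m_fin//; congr (_ + fine _).
    by apply/esym; apply: cone_shift; rewrite (ltW a0).
  - apply/seteqP; split => // z [/=]; rewrite /cone/=.
    set A := proj 0 z; set B := proj a z; set C := proj (a + b) z => AB BC.
    have : 0 <= sin (a + b) * B * B by rewrite -mulrA mulr_ge0// -expr2 sqr_ge0.
    have := rel z; rewrite -/A -/B -/C => ->.
    have : sin b * (A * B) < 0 by rewrite pmulr_rlt0.
    have : sin a * (B * C) < 0 by rewrite pmulr_rlt0.
    by lra.
congr fine; apply: (@null_eq _ _ ([set z | proj 0 z = 0] `|` [set z | proj a z = 0] `|`
   [set z | proj (a + b) z = 0])).
- exact: measurable_cone.
- exact: measurableU.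
- by do ?[apply: measurableU].
- rewrite !measureU0//; rewrite ?proj_null ?lexx ?pi_ge0 ?(ltW a0) ?(ltW api)
    ?abpi ?addr_ge0 ?ltW//.
  exact: measurableU.
- move=> z; rewrite /cone/=.
  set A := proj 0 z; set B := proj a z; set C := proj (a + b) z => AC.
  have [B0|B0|B0] := ltgtP B 0.
  + left; have [A0|A0] := ltP 0 A; [left; rewrite nmulr_llt0//|right; rewrite nmulr_rlt0//].
    by have [C0|C0] := ltP 0 C => //; move: AC; rewrite ltNge mulr_le0//.
  + left; have [A0|A0] := ltP 0 A; [right; rewrite pmulr_rlt0//|left; rewrite pmulr_llt0//].
      by move: AC; rewrite pmulr_rlt0.
    by rewrite lt_neqAle A0 andbT; apply/eqP => A00; move: AC; rewrite A00 mul0r ltxx.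
  + by right; left; right.
- move=> z; rewrite /cone/=.
  set A := proj 0 z; set B := proj a z; set C := proj (a + b) z => ABC.
  have [A0|A0] := eqVneq A 0; first by right; left; left.
  have [C0|C0] := eqVneq C 0; first by right; right.
  left; have relz := rel z; rewrite -/A -/B -/C in relz.
  rewrite ltNge; apply/negP => AC.
  have {AC} : 0 < A * C by rewrite lt_neqAle AC andbT eq_sym mulf_neq0.
  move=> AC; have AA : 0 < A * A by rewrite -expr2 exprn_even_gt0.
  have CC : 0 < C * C by rewrite -expr2 exprn_even_gt0.
  have pos1 : 0 < A * (sin b * A + sin a * C).
    by have := mulr_gt0 bpos AA; have := mulr_gt0 apos AC; lra.
  have pos2 : 0 < C * (sin b * A + sin a * C).
    by have := mulr_gt0 apos CC; have := mulr_gt0 bpos AC; lra.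
  move: pos1 pos2; rewrite -relz !(mulrCA _ (sin (a + b))) => pos1 pos2.
  case: ABC => [AB|BC].
    by have := mulr_ge0_le0 abpos (ltW AB); rewrite leNgt pos1.
  by rewrite mulrC in BC; have := mulr_ge0_le0 abpos (ltW BC); rewrite leNgt pos2.
Qed.

Let q_mono a b : 0 <= a -> a <= b -> b <= pi -> q a <= q b.
Proof.
move=> a0 ab bpi; rewrite -(subrKC a b) cone_add ?subr_ge0// ?subrKC//.
by rewrite lerDl fine_ge0.
Qed.

Let q0 : q 0 = 0.
Proof.
have := @cone_add 0 0 (lexx 0) (lexx 0); rewrite addr0 pi_ge0 => /(_ isT) => h.
by lra.
Qed.

Let qpi : q pi = 1.
Proof.
rewrite /q; have -> : m (cone 0 pi) = m setT; last by rewrite mT.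
apply: (@null_eq _ _ [set z | proj 0 z = 0]) => //.
- by rewrite proj_null// lexx pi_ge0.
- by move=> z _; left.
- move=> z _; rewrite /cone/= /proj cospi sinpi cos0 sin0 !mul0r !addr0 mulN1r mul1r.
  rewrite mulrN oppr_lt0 -expr2.
  by have [z0|z0] := eqVneq z.1 0; [right|left; rewrite exprn_even_gt0].
Qed.

Let q_mul (k : nat) a : 0 <= a -> k%:R * a <= pi -> q (k%:R * a) = k%:R * q a.
Proof.
move=> a0; elim: k => [|k IH]; first by rewrite !mul0r q0.
move=> kpi; have ka : k%:R * a + a <= pi by rewrite -[X in _ + X]mul1r -mulrDl natr1.
rewrite -natr1 mulrDl mul1r cone_add ?mulr_ge0// IH ?mulrDl ?mul1r//.
by rewrite (le_trans _ ka)// lerDl.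
Qed.

(* q is monotone, additive and q pi = 1, which determines it at the multiples
   of pi / M and hence everywhere. *)
Lemma rotation_invariant_angle t : 0 <= t <= pi ->
  m [set z : mRR | z.1 * (cos t * z.1 + sin t * z.2) < 0] = (t / pi)%:E.
Proof.
move=> /andP[t0 tpi]; have pi0 : 0 < pi :> R := pi_gt0 R.
have -> : [set z : mRR | z.1 * (cos t * z.1 + sin t * z.2) < 0] = cone 0 t.
  by apply/funext => z; rewrite /cone /proj/= cos0 sin0 mul0r addr0 mul1r.
rewrite -[LHS]fineK ?m_fin//; congr EFin; rewrite -/(q t).
move: tpi; rewrite le_eqVlt => /orP[/eqP ->|tpi]; first by rewrite qpi divff// gt_eqF.
have qM (M k : nat) : (k <= M.+1)%N -> q (k%:R * (pi / M.+1%:R)) = k%:R / M.+1%:R.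
  move=> kM; have M0 : 0 < M.+1%:R :> R by rewrite ltr0n.
  have pE : M.+1%:R * (pi / M.+1%:R) = pi :> R by rewrite mulrC divfK ?gt_eqF.
  have q1 : q (pi / M.+1%:R) = M.+1%:R^-1.
    have := @q_mul M.+1 (pi / M.+1%:R); rewrite pE qpi lexx.
    move=> /(_ (divr_ge0 (ltW pi0) (ltW M0)) isT) h.
    by apply: (mulfI (lt0r_neq0 M0)); rewrite -h divff// gt_eqF.
  rewrite q_mul ?q1 ?divr_ge0 ?(ltW pi0)//.
  rewrite mulrA ler_pdivrMr// mulrC ler_pM2l// ler_nat//.
apply/eqP; rewrite -subr_eq0 -normr_eq0; apply/eqP/le_anti/andP; split => //.
apply/ler_addgt0Pr => e e0; rewrite add0r.
pose M := Num.truncn e^-1; have M0 : 0 < M.+1%:R :> R by rewrite ltr0n.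
have Me : M.+1%:R^-1 <= e.
  rewrite invf_ple ?posrE// ltW//; have /truncn_itv/andP[_] : 0 <= e^-1 by rewrite invr_ge0 ltW.
  by [].
apply: le_trans Me.
have x0 : 0 <= t / (pi / M.+1%:R) by rewrite divr_ge0// divr_ge0// ltW.
have pM0 : 0 < pi / M.+1%:R :> R by rewrite divr_gt0.
(* t lies between the multiples j and j + 1 of pi / (M + 1); by monotonicity both q t and t / pi lie
   between j / (M + 1) and (j + 1) / (M + 1), hence differ by at most 1 / (M + 1). *)
set j := Num.truncn (t / (pi / M.+1%:R)).
have /truncn_itv/andP[] := x0; rewrite -/j ler_pdivlMr// ltr_pdivrMr// => jt tj.
have jM : (j.+1 <= M.+1)%N.
  rewrite -(ltr_nat R) -(ltr_pM2r pM0) (le_lt_trans jt)//.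
  by rewrite mulrC divfK ?gt_eqF.
have ql : j%:R / M.+1%:R <= q t.
  by rewrite -qM ?(leq_trans (leqnSn j))// q_mono// ?mulr_ge0 ?(ltW pM0)// ltW.
have qr : q t <= j.+1%:R / M.+1%:R.
  rewrite -qM// q_mono// ?(ltW tj)//.
  rewrite mulrA ler_pdivrMr// mulrC ler_pM2l// ler_nat//.
have tl : j%:R / M.+1%:R <= t / pi.
  by rewrite ler_pdivlMr// mulrAC -mulrA.
have tr : t / pi <= j.+1%:R / M.+1%:R.
  by rewrite ler_pdivrMr// mulrAC -mulrA ltW.
rewrite ler_norml; move: ql qr tl tr; rewrite -[j.+1%:R]natr1 mulrDl mul1r.
set u := _ / _; set v := _^-1; set w := _ / _; lra.
Qed.

End RotationInvariant.

Lemma normal2_angle {R : realType} (t : R) : 0 <= t <= pi ->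
  (normal_prob 0 1 \x normal_prob 0 1)%E
    [set z : measurableTypeR R * measurableTypeR R |
      z.1 * (cos t * z.1 + sin t * z.2) < 0] = (t / pi)%:E.
Proof.
apply: rotation_invariant_angle.
- exact: normal2_setT.
- apply: etrans (normal2_setX _ _) _ => //.
  by have -> := normal_prob_set1 (0 : R); rewrite mul0e.
- exact: normal2_rot.
Qed.

Section GaussianCombinations.
Context (d : measure_display) (T : measurableType d) (R : realType).
Variables (P : probability T R) (n : nat) (X : 'I_n -> {RV P >-> R}).
Hypotheses (indX : independent_RVs X) (stdX : forall i, standard_normal (X i)).
Local Notation mR := (measurableTypeR R).
Local Notation mRR := (mR * mR)%type.
Local Notation gam := (@normal_prob R 0 1).

Definition lincomb (u : 'I_n -> R) (w : T) : R := \sum_i u i * X i w.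

Lemma measurable_lincomb u : measurable_fun [set: T] (lincomb u : T -> mR).
Proof.
by apply: measurable_sum => i; apply: measurable_funM.
Qed.

Lemma measurable_lincomb_set (u : 'I_n -> R) (A : set mR) : measurable A ->
  measurable (lincomb u @^-1` A).
Proof. by move=> mA; rewrite -[X in measurable X]setTI; exact: measurable_lincomb. Qed.

(** The density is at most 1 / sqrt (2 pi), hence at most 1. *)
Lemma normal_prob_itv_le (x : R) : 0 <= x ->
  (gam `[(- x)%R, x] <= (2 * x)%:E)%E.
Proof.
move=> x0; rewrite /normal_prob.
apply: (@le_trans _ _ (\int[lebesgue_measure]_(y in `[(- x)%R, x]) 1%:E)%E).
  apply: ge0_le_integral => //.
  - by move=> y _; rewrite lee_fin normal_pdf_ge0.
  - by apply/measurable_EFinP/measurable_funTS; exact: measurable_normal_pdf.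
  - move=> y _; rewrite lee_fin (le_trans (normal_pdf_ub _ _ _)) ?oner_neq0//.
    rewrite /normal_peak expr1n mul1r invf_le1; last first.
      by rewrite sqrtr_gt0 mulrn_wgt0// pi_gt0.
    rewrite -sqrtr1 ler_wsqrtr//.
    by have := pi_ge2 R; lra.
rewrite integral_cst//= mul1e lebesgue_measure_itv/= lte_fin.
by case: ifP => _; rewrite -?EFinB lee_fin; lra.
Qed.

(** First marginal of the pair law, applied to u twice. *)
Lemma lincomb_law1 (u : 'I_n -> R) (A : set mR) : measurable A ->
  P (lincomb u @^-1` A) = gam [set x | A (Num.sqrt (\sum_i u i ^+ 2) * x)].
Proof.
move=> mA.
have [a [b [c [a0 c0 [ha _ _] h]]]] := gaussian_pair_law indX stdX u u.
have aE : Num.sqrt (\sum_i u i ^+ 2) = a by rewrite -ha sqrtr_sqr ger0_norm.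
have mAT : measurable (A `*` [set: mR]) by exact: measurableX.
have -> : lincomb u @^-1` A = [set w | (A `*` [set: mR])
    ((\sum_i u i * X i w, \sum_i u i * X i w) : mRR)].
  by apply/seteqP; split => w // [].
rewrite h// aE.
have mA' : measurable [set x : mR | A (a * x)].
  by rewrite -[X in measurable X]setTI; exact: measurable_funM.
rewrite (_ : [set z | _] = [set x | A (a * x)] `*` [set: mR]); last first.
  by apply/seteqP; split => z // [].
rewrite normal2_setX//; have -> : gam setT = 1%E by exact: probability_setT.
by rewrite mule1.
Qed.

Lemma lincomb_small_ball (u : 'I_n -> R) (x : R) :
  0 < \sum_i u i ^+ 2 -> 0 <= x ->
  (P [set w | (`|lincomb u w| <= x)%R] <=
   (2 * (x / Num.sqrt (\sum_i u i ^+ 2)))%:E)%E.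
Proof.
move=> u0 x0; set a := Num.sqrt _.
have a0 : 0 < a by rewrite sqrtr_gt0.
have -> : [set w | `|lincomb u w| <= x] = lincomb u @^-1` `[(- x)%R, x]%classic.
  by apply/funext => w; rewrite /= in_itv/= ler_norml.
rewrite lincomb_law1//.
have -> : [set y | `[(- x)%R, x]%classic (a * y)] = `[(- (x / a))%R, x / a]%classic.
  apply/funext => y; rewrite /= !in_itv/= -mulNr ler_pdivrMr// ler_pdivlMr//.
  by rewrite (mulrC y).
by apply: normal_prob_itv_le; rewrite divr_ge0// ltW.
Qed.

Lemma lincomb_eq0 (u : 'I_n -> R) : 0 < \sum_i u i ^+ 2 ->
  P [set w | lincomb u w = 0] = 0%E.
Proof.
move=> u0; rewrite (_ : [set w | _] = lincomb u @^-1` [set 0])//.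
rewrite lincomb_law1//; set a := Num.sqrt _.
have a0 : a != 0 by rewrite gt_eqF// sqrtr_gt0.
rewrite (_ : [set x | _] = [set 0]); first exact: normal_prob_set1.
apply/seteqP; split => x /=; last by move=> ->; rewrite mulr0.
by move/eqP; rewrite mulf_eq0 (negbTE a0)/= => /eqP.
Qed.

(** The Gram matrix forces b = a r and c = a sin (acos r): up to the factor a, the pair is (x, cos t
    x + sin t y) with t = acos r, and the event becomes the double cone of angle t. *)
Lemma lincomb_sign_change (u v : 'I_n -> R) (N r : R) : 0 < N ->
  \sum_i u i ^+ 2 = N -> \sum_i v i ^+ 2 = N -> \sum_i u i * v i = N * r ->
  P [set w | lincomb u w * lincomb v w < 0] = (acos r / pi)%:E.
Proof.
move=> N0 uN vN uvN.
have [a [b [c [a0 c0 [ha hb hc] h]]]] := gaussian_pair_law indX stdX u v.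
rewrite uN in ha; rewrite vN in hc; rewrite uvN in hb.
have a_neq0 : a != 0 by apply: contraPneq ha => ->; rewrite expr0n/=; lra.
have bE : b = a * r.
  by apply: (mulfI a_neq0); rewrite hb -ha; ring.
have ccE : c ^+ 2 = a ^+ 2 * (1 - r ^+ 2).
  by transitivity (N - b ^+ 2); [rewrite -hc; ring|rewrite bE -ha; ring].
have r1 : r ^+ 2 <= 1.
  have : 0 <= a ^+ 2 * (1 - r ^+ 2) by rewrite -ccE sqr_ge0.
  by rewrite pmulr_rge0 ?subr_ge0// ha.
have rint : -1 <= r <= 1.
  by rewrite -ler_norml -ler_sqr ?nnegrE// expr1n real_normK// num_real.
have ct : cos (acos r) = r by rewrite acosK// in_itv.
have st : sin (acos r) = Num.sqrt (1 - r ^+ 2) by rewrite sin_acos.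
have cE : c = a * sin (acos r).
  rewrite st -(ger0_norm c0) -sqrtr_sqr ccE sqrtrM ?sqr_ge0//.
  by rewrite sqrtr_sqr ger0_norm.
pose E : set mRR := [set z | z.1 * z.2 < 0].
have mE : measurable E by apply: measurable_mul_lt0.
rewrite (h E mE) -(normal2_angle (t := acos r)); last first.
  by rewrite acos_ge0// acos_lepi.
congr (_ _); apply/funext => z; rewrite /E/= bE cE ct.
have -> : a * z.1 * (a * r * z.1 + a * sin (acos r) * z.2) =
  a ^+ 2 * (z.1 * (r * z.1 + sin (acos r) * z.2)) by ring.
by rewrite pmulr_rlt0// ha.
Qed.

(** The weak event adds only the vanishing of one of the forms, which is null. *)
Lemma lincomb_sign_changeW (u v : 'I_n -> R) (N r : R) : 0 < N ->
  \sum_i u i ^+ 2 = N -> \sum_i v i ^+ 2 = N -> \sum_i u i * v i = N * r ->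
  P [set w | lincomb u w * lincomb v w <= 0] = (acos r / pi)%:E.
Proof.
move=> N0 uN vN uvN; rewrite -(lincomb_sign_change N0 uN vN uvN).
set A := [set w | _ < 0]; set B := [set w | _ <= 0].
have mu0 x : measurable [set w | lincomb x w = 0].
  exact: (@measurable_lincomb_set x [set 0]).
have mA : measurable A by apply: measurable_mul_lt0; exact: measurable_lincomb.
pose Z := [set w | lincomb u w = 0] `|` [set w | lincomb v w = 0].
have BE : B = A `|` Z.
  apply/funext => w; rewrite /B /A /Z/=; apply/propext; split.
    rewrite le_eqVlt => /orP[|?]; last by left.
    by rewrite mulf_eq0 => /orP[/eqP|/eqP]; right; [left|right].
  by case=> [/ltW//|[->|->]]; rewrite ?mul0r ?mulr0.
have mZ : measurable Z by exact: measurableU.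
rewrite BE measureU0// /Z measureU0//; apply: lincomb_eq0; by rewrite ?uN ?vN.
Qed.

End GaussianCombinations.

(** * Asymptotics of the mesh angle *)

Section AngleLimit.
Context {R : realType}.

Let sinc (x : R) : R := if x == 0 then 1 else sin x / x.

Let sincE x : sin x = x * sinc x.
Proof.
rewrite /sinc; case: eqVneq => [->|x0]; first by rewrite sin0 mul0r.
by rewrite mulrC divfK.
Qed.

Let sinc_cvg (u : nat -> R) : u @ \oo --> 0 -> (sinc \o u) @ \oo --> (1 : R).
Proof.
move=> u0.
have : {for 0, continuous sinc}.
  apply/continuous_withinNx; rewrite /sinc eqxx.
  have [drv drvE] := is_derive_sin (0 : R).
  have cvgq : h^-1 *: (sin (h *: 1 + 0) - sin 0) @[h --> 0^'] --> (cos 0 : R).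
    by rewrite -drvE; exact: drv.
  rewrite -[X in _ --> X]cos0; apply: cvg_trans cvgq; apply: near_eq_cvg.
  near=> h; have h0 : h != 0 by near: h; exact: nbhs_dnbhs_neq.
  by rewrite (negbTE h0) /GRing.scale/= mulr1 addr0 sin0 subr0 mulrC.
move=> c; have : (sinc \o u) @ \oo --> sinc 0 by exact: cvg_comp u0 c.
by rewrite [X in _ --> X]/sinc eqxx.
Unshelve. all: by end_near. Qed.

(** The correlation tends to 1, where acos is not differentiable, so half angles are used instead of
    an expansion: sin (al m / 2) is exactly [y m], the root mean square of the sin (l pi / m). Then
    m y(m) tends to pi times the root mean square of the frequencies, and dividing by sinc (al m /
    2), which tends to 1, turns the sine into the angle. *)
Lemma cvg_angle_rms (L : {fset int}) : (0 < #|` L|)%N ->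
  (fun m : nat => m%:R * (acos ((#|` L|%:R)^-1 *
      \sum_(l <- L) cos (l%:~R * (2 * pi / m%:R))) / pi)) @ \oo -->
  2 * Num.sqrt ((#|` L|%:R)^-1 * \sum_(l <- L) (l%:~R : R) ^+ 2).
Proof.
move=> L0; set N := #|` L|; have N0 : 0 < N%:R :> R by rewrite ltr0n.
have pi0 := pi_gt0 R.
pose r (m : nat) : R := N%:R^-1 * \sum_(l <- L) cos (l%:~R * (2 * pi / m%:R)).
pose y (m : nat) : R :=
  Num.sqrt (N%:R^-1 * \sum_(l <- L) sin (l%:~R * (pi / m%:R)) ^+ 2).
pose al m := acos (r m).
have sumle (F : int -> R) : (forall l, F l <= 1) -> \sum_(l <- L) F l <= N%:R.
  move=> F1; apply: (@le_trans _ _ (\sum_(l <- L) 1)); first exact: ler_sum.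
  by rewrite big_const_seq count_predT iter_addr_0.
have rint m : -1 <= r m <= 1.
  apply/andP; split; last first.
    by rewrite /r mulrC ler_pdivrMr// mul1r; apply: sumle => l; exact: cos_le1.
  rewrite /r mulrC ler_pdivlMr// mulN1r lerNl -sumrN; apply: sumle => l.
  by rewrite lerNl cos_geN1.
have al0 m : 0 <= al m / 2 by rewrite divr_ge0// acos_ge0.
have alpi m : al m / 2 <= pi / 2 by rewrite ler_pM2r// acos_lepi.
have ral m : 1 - r m = 2 * (N%:R^-1 * \sum_(l <- L) sin (l%:~R * (pi / m%:R)) ^+ 2).
  have -> : 1 - r m = N%:R^-1 * \sum_(l <- L) (1 - cos (l%:~R * (2 * pi / m%:R))).
    by rewrite sumrB mulrBr big_const_seq count_predT iter_addr_0 mulVf// gt_eqF.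
  rewrite mulrCA; congr (_ * _); rewrite mulr_sumr.
  apply: eq_bigr => l _.
  have -> : l%:~R * (2 * pi / m%:R) = (l%:~R * (pi / m%:R)) *+ 2 :> R.
    by rewrite -mulr_natl; ring.
  by rewrite cos_mulr2n cos2sin2; ring.
have sy m : sin (al m / 2) = y m.
  have s0 : 0 <= sin (al m / 2).
    apply: sin_ge0_pi; rewrite al0/= (le_trans (alpi m))//.
    by rewrite ler_pdivrMr//; lra.
  rewrite -(ger0_norm s0) -sqrtr_sqr /y; congr Num.sqrt.
  have := cos_mulr2n (al m / 2); rewrite -[(al m / 2) *+ 2]mulr_natr divfK//.
  rewrite acosK ?in_itv//= cos2sin2; have := ral m; lra.
have ysin m : al m / 2 = asin (y m).
  rewrite -sy sinK// in_itv/= alpi andbT (le_trans _ (al0 m))// lerNl oppr0.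
  by rewrite divr_ge0// ltW.
have u0 (l : int) : (fun m : nat => l%:~R * (pi / m%:R) : R) @ \oo --> (0 : R).
  rewrite -[X in _ --> X](mulr0 (l%:~R * pi)).
  have -> : (fun m : nat => l%:~R * (pi / m%:R) : R) =
      (fun m : nat => l%:~R * pi * m%:R^-1) by apply/funext => m; rewrite mulrA.
  apply: cvgMl_tmp; apply/gtr0_cvgV0; last exact: cvgr_idn.
  by exists 1%N => // m /= m1; rewrite ltr0n.
have my : (fun m : nat => m%:R * y m) @ \oo -->
    pi * Num.sqrt (N%:R^-1 * \sum_(l <- L) (l%:~R : R) ^+ 2).
  have -> : pi * Num.sqrt (N%:R^-1 * \sum_(l <- L) (l%:~R : R) ^+ 2) =
     Num.sqrt (N%:R^-1 * \sum_(l <- L) (l%:~R * pi * 1) ^+ 2).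
    rewrite -{1}(ger0_norm (ltW pi0)) -sqrtr_sqr -sqrtrM ?sqr_ge0//.
    congr Num.sqrt; rewrite mulrCA mulr_sumr; congr (_ * _).
    by apply: eq_bigr => l _; ring.
  have : (fun m : nat => Num.sqrt (N%:R^-1 * \sum_(l <- L)
      (l%:~R * pi * sinc (l%:~R * (pi / m%:R))) ^+ 2)) @ \oo -->
     Num.sqrt (N%:R^-1 * \sum_(l <- L) (l%:~R * pi * 1) ^+ 2).
    have cs (v : nat -> R) (x : R) : v @ \oo --> x ->
        (fun m => Num.sqrt (v m)) @ \oo --> Num.sqrt x.
      by move=> vx; exact: cvg_comp vx (@sqrt_continuous R x).
    apply: cs; apply: cvgMl_tmp.
    have csum (s : seq int) : (fun m : nat => \sum_(l <- s)
        (l%:~R * pi * sinc (l%:~R * (pi / m%:R))) ^+ 2) @ \oo -->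
        (\sum_(l <- s) (l%:~R * pi * 1) ^+ 2 : R).
      elim: s => [|l s IH].
        rewrite big_nil (_ : (fun m => _) = cst 0); first exact: cvg_cst.
        by apply/funext => m; rewrite big_nil.
      rewrite big_cons (_ : (fun m => _) = (fun m : nat =>
        (l%:~R * pi * sinc (l%:~R * (pi / m%:R))) ^+ 2) \+ (fun m : nat =>
        \sum_(l <- s) (l%:~R * pi * sinc (l%:~R * (pi / m%:R))) ^+ 2)); last first.
        by apply/funext => m; rewrite big_cons.
      apply: cvgD => //.
      have csqr (v : nat -> R) (x : R) : v @ \oo --> x ->
          (fun m => v m ^+ 2) @ \oo --> x ^+ 2.
        by move=> vx; exact: cvg_comp vx (@exprn_continuous R 2 x).
      by apply: csqr; apply: cvgMl_tmp; exact: (sinc_cvg (u0 l)).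
    exact: csum.
  apply: cvg_trans; apply: near_eq_cvg.
  exists 1%N => // m /= m1; have m0 : (0 : R) < m%:R by rewrite ltr0n.
  suff -> : m%:R * y m = Num.sqrt (N%:R^-1 * \sum_(l <- L)
      (l%:~R * pi * sinc (l%:~R * (pi / m%:R))) ^+ 2) by [].
  rewrite /y -{1}(ger0_norm (ltW m0)) -sqrtr_sqr -sqrtrM ?sqr_ge0//.
  congr Num.sqrt; rewrite mulrCA mulr_sumr; congr (_ * _).
  apply: eq_bigr => l _; rewrite sincE; field.
  by rewrite gt_eqF.
have y0 : y @ \oo --> (0 : R).
  have h : (fun m : nat => m%:R^-1 * (m%:R * y m)) @ \oo --> (0 : R).
    rewrite -[X in _ --> X](mul0r (pi * Num.sqrt (N%:R^-1 * \sum_(l <- L) (l%:~R : R) ^+ 2))).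
    apply: cvgM my; apply/gtr0_cvgV0; last exact: cvgr_idn.
    by exists 1%N => // m /= m1; rewrite ltr0n.
  apply: cvg_trans h; apply: near_eq_cvg; exists 1%N => // m /= m1.
  by rewrite mulrA mulVf ?mul1r// pnatr_eq0 -lt0n.
have a0 : (fun m => al m / 2) @ \oo --> (0 : R).
  have -> : (fun m => al m / 2) = asin \o y by apply/funext => m; exact: ysin.
  have -> : 0 = asin 0 :> R by rewrite -{2}sin0 sinK// in_itv/= lerNl oppr0 divr_ge0 ?ltW.
  apply: continuous_cvg y0; apply: continuous_asin; lra.
have s1 := sinc_cvg a0.
have main : (fun m : nat => 2 / pi * ((m%:R * y m) / sinc (al m / 2))) @ \oo -->
   2 / pi * (pi * Num.sqrt (N%:R^-1 * \sum_(l <- L) (l%:~R : R) ^+ 2) / 1).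
  apply: cvgMl_tmp; apply: cvgM my _; apply: cvgV s1; exact: oner_neq0.
have -> : 2 * Num.sqrt (N%:R^-1 * \sum_(l <- L) (l%:~R : R) ^+ 2) =
   2 / pi * (pi * Num.sqrt (N%:R^-1 * \sum_(l <- L) (l%:~R : R) ^+ 2) / 1).
  by rewrite divr1 mulrA divfK// gt_eqF.
apply: cvg_trans main; apply: near_eq_cvg.
near=> m.
have sn0 : sinc (al m / 2) != 0.
  rewrite gt_eqF//; near: m.
  have := cvgr_gt _ s1 _ ltr01; exact.
rewrite -/(r m) -/(al m) -sy (sincE (al m / 2)) mulrA mulfK//.
have p0 : pi != 0 :> R by rewrite gt_eqF.
by move: (pi : R) p0 => p p0; field.
Unshelve. all: by end_near. Qed.

End AngleLimit.

(** * Trigonometric polynomials and sign changes on a grid *)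

Section TrigPoly.
Context {R : realType}.
Implicit Types (s : seq int) (p r : int -> R) (t : R).

(** Real form on the circle, with separate cosine and sine coefficients: the derivative is again of
    this form over the same frequencies, so that one bound serves all derivatives. *)
Definition trigp s p r t : R :=
  \sum_(l <- s) (p l * cos (l%:~R * t) + r l * sin (l%:~R * t)).

Lemma is_derive_trigp s p r t :
  is_derive t 1 (trigp s p r)
    (trigp s (fun l => l%:~R * r l) (fun l => - (l%:~R * p l)) t).
Proof.
elim: s => [|l s IH].
  rewrite /trigp big_nil.
  rewrite (_ : (fun t => _) = cst 0); first exact: is_derive_cst.
  by apply/funext => x; rewrite big_nil.
have -> : trigp (l :: s) p r = (fun t => p l * cos (l%:~R * t)) \+
    (fun t => r l * sin (l%:~R * t)) \+ trigp s p r.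
  by apply/funext => x; rewrite /trigp big_cons.
rewrite /trigp big_cons -/(trigp _ _ _ _).
have dl : is_derive t 1 (fun t : R => l%:~R * t) (l%:~R).
  have := @is_deriveZ _ _ _ _ (l%:~R : R) _ _ _ (@is_derive_id _ R t 1).
  by rewrite /GRing.scale/= mulr1.
have dc := is_derive1_comp (is_derive_cos (l%:~R * t)) dl.
have ds := is_derive1_comp (is_derive_sin (l%:~R * t)) dl.
have dc' := @is_deriveZ _ _ _ _ (p l) _ _ _ dc.
have ds' := @is_deriveZ _ _ _ _ (r l) _ _ _ ds.
have := is_deriveD (is_deriveD dc' ds') IH.
move/(@is_derive_eq _ _ _ _ _ _ _ _); apply.
by rewrite /GRing.scale/=; congr (_ + _); ring.
Qed.

Lemma trigp_continuous s p r : continuous (trigp s p r).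
Proof.
move=> t; apply: differentiable_continuous; apply/derivable1_diffP.
by have [] := is_derive_trigp s p r t.
Qed.

Lemma trigp_bound s p r t : `|trigp s p r t| <= \sum_(l <- s) (`|p l| + `|r l|).
Proof.
apply: le_trans (ler_norm_sum _ _ _) _; apply: ler_sum => l _.
apply: le_trans (ler_normD _ _) _; rewrite !normrM.
by apply: lerD; rewrite ler_piMr// ?cos_max ?sin_max.
Qed.

End TrigPoly.

Section SmoothFunctions.
Context {R : realType}.
Variables (f df : R -> R).
Hypothesis fdf : forall t : R, is_derive t 1 f (df t).

Let cf : continuous f.
Proof.
move=> t; apply: differentiable_continuous; apply/derivable1_diffP.
by have [] := fdf t.
Qed.

(** The derivative is bounded only as far from a as x is, so M may depend on x; this is what lets
    [trigp_double_zero] reach a quadratic bound. *)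
Lemma lipschitz_is_derive (M : R) (a x : R) :
  (forall y, `|y - a| <= `|x - a| -> `|df y| <= M) -> `|f x - f a| <= M * `|x - a|.
Proof.
move=> dfM.
have [ax|xa] := leP a x.
  have [c /[!in_itv]/= /andP[ac cx] ->] := MVT_segment ax (fun y _ => fdf y)
    (continuous_subspaceT cf).
  rewrite normrM ler_wpM2r//; apply: dfM.
  by rewrite !ger0_norm ?subr_ge0// lerD2r.
have [c /[!in_itv]/= /andP[xc ca] h] := MVT_segment (ltW xa) (fun y _ => fdf y)
  (continuous_subspaceT cf).
rewrite distrC h normrM (distrC x) ler_wpM2r//; apply: dfM.
by rewrite distrC (distrC x) !ger0_norm ?subr_ge0// ?lerD2l ?lerN2// ltW.
Qed.

(** Near t the difference quotient is within |df t| of df t, hence has its sign. The product form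
    avoids a case distinction on the signs of x - t and df t. *)
Lemma simple_zero_sign (t : R) : f t = 0 -> df t != 0 ->
  exists2 e : R, 0 < e & forall x, x != t -> `|x - t| < e ->
    0 < f x * (x - t) * df t.
Proof.
move=> ft0 dft0.
have [drv drvE] := fdf t.
have cvgq : h^-1 *: (f (h *: 1 + t) - f t) @[h --> 0^'] --> df t.
  by rewrite -drvE; exact: drv.
have e0 : 0 < `|df t| by rewrite normr_gt0.
have /cvgrPdist_lt/(_ _ e0) := cvgq.
move=> [e /= egt0 he]; exists e => // x xt xe.
have := he (x - t); rewrite /= sub0r normrN xe subr_eq0 => /(_ isT xt).
rewrite /GRing.scale/= mulr1 subrK ft0 subr0.
set q := _^-1 * f x => hq.
have xt0 : x - t != 0 by rewrite subr_eq0.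
have fxE : f x = (x - t) * q by rewrite /q mulrA mulfV// mul1r.
have : 0 < q * df t.
  have [dpos|dneg|dz] := ltgtP (df t) 0.
  - rewrite nmulr_lgt0//; move: hq; rewrite (ltr0_norm dpos) ltr_norml; lra.
  - rewrite pmulr_lgt0//; move: hq; rewrite (gtr0_norm dneg) ltr_norml; lra.
  - by rewrite dz eqxx in dft0.
move=> qd; rewrite fxE (_ : _ * _ * _ * _ = (x - t) ^+ 2 * (q * df t)); last by ring.
by rewrite mulr_gt0// exprn_even_gt0.
Qed.

End SmoothFunctions.

(** The mean value theorem used twice, with M a bound on the second derivative. M depends on the
    coefficients but not on the position of the double zero. *)
Lemma trigp_double_zero {R : realType} (s : seq int) (p r : int -> R) :
  exists2 M : R, 0 <= M & forall t x,
    trigp s p r t = 0 ->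
    trigp s (fun l => l%:~R * r l) (fun l => - (l%:~R * p l)) t = 0 ->
    `|trigp s p r x| <= M * (x - t) ^+ 2.
Proof.
pose f := trigp s p r; pose p1 (l : int) := l%:~R * r l : R.
pose r1 (l : int) := - (l%:~R * p l) : R; pose df := trigp s p1 r1.
rewrite -/f -/p1 -/r1 -/df.
pose M : R := \sum_(l <- s) (`|l%:~R * r1 l| + `|- (l%:~R * p1 l)|).
exists M.
  by apply: sumr_ge0 => l _; rewrite addr_ge0.
move=> t x ft dft.
have dfM y : `|df y| <= M * `|y - t|.
  have := @lipschitz_is_derive _ df _ (is_derive_trigp s p1 r1) M t y.
  by rewrite dft subr0; apply => z _; exact: trigp_bound.
have := @lipschitz_is_derive _ f _ (is_derive_trigp s p r) (M * `|x - t|) t x.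
rewrite ft subr0 -mulrA -expr2 real_normK ?num_real//; apply => y yx.
rewrite (le_trans (dfM y))// ler_wpM2l//.
by apply: sumr_ge0 => l _; rewrite addr_ge0.
Qed.

Lemma card_le_counting {R : realType} {T : choiceType} (I : finType)
    (J : {set I}) (g : I -> T) (A : set T) :
  {in J &, injective g} -> (forall j, j \in J -> A (g j)) ->
  (#|J|%:R%:E <= counting A :> \bar R)%E.
Proof.
move=> ginj gA; rewrite /counting; case: asboolP => [Afin|_]; last exact: leey.
rewrite lee_fin ler_nat cardE -(size_map g).
apply: uniq_leq_size.
  rewrite map_inj_in_uniq ?enum_uniq// => x y; rewrite !mem_enum; exact: ginj.
by move=> _ /mapP[j + ->]; rewrite mem_enum in_fset_set// => jJ; apply/mem_set; exact: gA.
Qed.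

(** An infinite A has finite subsets of every size, which forces x to be infinite; so the set of
    roots need not be shown finite. *)
Lemma counting_le {R : realType} {T : choiceType} (A : set T) (x : \bar R) :
  (forall B : {fset T}, [set` B] `<=` A -> (#|` B|%:R%:E <= x)%E) ->
  (counting A <= x)%E.
Proof.
move=> h; rewrite /counting; case: asboolP => [Afin|Ainf].
  by apply: h => y /=; rewrite in_fset_set// => /set_mem.
suff -> : x = +oo%E by [].
case: x h => [r|//|] h.
  have [B BA Bn] := infinite_set_fset (Num.truncn r).+1 Ainf.
  have := h B BA; rewrite lee_fin => Br.
  have r0 : 0 <= r by rewrite (le_trans _ Br).
  have /truncn_itv/andP[_ rlt] := r0.
  have : ((Num.truncn r).+1%:R <= r :> R)%R by rewrite (le_trans _ Br)// ler_nat.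
  by rewrite leNgt rlt.
by have /h : [set` (fset0 : {fset T})] `<=` A by move=> y /=; rewrite inE.
Qed.

Section Grid.
Context {R : realType}.
Implicit Types (f : R -> R) (m : nat).

Definition grid m (j : nat) : R := 2 * pi * j%:R / m%:R.

Definition sign_changes f m : {set 'I_m} :=
  [set j : 'I_m | f (grid m j) * f (grid m j.+1) < 0]%SET.

(** Retains the cells with a zero at an end, so that a root on a grid point is not missed. *)
Definition weak_sign_changes f m : {set 'I_m} :=
  [set j : 'I_m | f (grid m j) * f (grid m j.+1) <= 0]%SET.

Lemma grid_lt m (i j : nat) : (0 < m)%N -> (grid m i < grid m j) = (i < j)%N.
Proof.
move=> m0; rewrite /grid ltr_pM2r ?invr_gt0 ?ltr0n// ltr_pM2l ?ltr_nat//.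
by rewrite mulr_gt0// pi_gt0.
Qed.

Lemma grid_le m (i j : nat) : (0 < m)%N -> (grid m i <= grid m j) = (i <= j)%N.
Proof. by move=> m0; rewrite leNgt grid_lt// -leqNgt. Qed.

Lemma grid0 m : grid m 0 = 0. Proof. by rewrite /grid mulr0 mul0r. Qed.

Lemma gridm m : (0 < m)%N -> grid m m = 2 * pi.
Proof. by move=> m0; rewrite /grid mulfK// pnatr_eq0 -lt0n. Qed.

Lemma gridS m j : grid m j.+1 = grid m j + 2 * pi / m%:R.
Proof. by rewrite /grid -natr1; ring. Qed.

Lemma grid_cell m (t : R) : (0 < m)%N -> 0 <= t < 2 * pi ->
  exists2 j, (j < m)%N & grid m j <= t < grid m j.+1.
Proof.
move=> m0 /andP[t0 t2]; have pi0 : 0 < 2 * pi :> R by rewrite mulr_gt0// pi_gt0.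
have h0 : 0 < 2 * pi / m%:R :> R by rewrite divr_gt0// ltr0n.
have /truncn_itv/andP[] : 0 <= t / (2 * pi / m%:R) by rewrite divr_ge0// ltW.
set j := Num.truncn _; rewrite ler_pdivlMr// ltr_pdivrMr// => jt tj.
have gE i : grid m i = i%:R * (2 * pi / m%:R) by rewrite /grid; ring.
exists j; last by rewrite !gE jt.
by rewrite -(grid_lt _ _ m0) gridm// gE (le_lt_trans jt).
Qed.

(** The zero found in a cell is interior, as the ends have nonzero values; this separates the zeros
    of adjacent cells and keeps them below 2 pi, where h is injective. *)
Lemma sign_changes_le_counting {T : choiceType} f (h : R -> T) (A : set T) m :
  continuous f ->
  (forall x y, 0 <= x < 2 * pi -> 0 <= y < 2 * pi -> h x = h y -> x = y) ->
  (forall x, 0 <= x < 2 * pi -> f x = 0 -> A (h x)) ->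
  (#|sign_changes f m|%:R%:E <= counting A :> \bar R)%E.
Proof.
move=> cf hinj hA.
have key (j : 'I_m) : exists x, j \in sign_changes f m ->
    grid m j < x < grid m j.+1 /\ f x = 0.
  have [jS|jS] := boolP (j \in sign_changes f m); last by exists 0.
  have m0 : (0 < m)%N by rewrite (leq_ltn_trans _ (ltn_ord j)).
  move: jS; rewrite inE => jS.
  have gle : grid m j <= grid m j.+1 by rewrite grid_le.
  have [x + fx0] : exists2 x, x \in `[grid m j, grid m j.+1] & f x = 0.
    apply: IVT => //; first exact: continuous_subspaceT.
    rewrite ge_min le_max; move: jS.
    set a := f _; set b := f _ => ab.
    have [a0|a0] := leP a 0; have [b0|b0] := leP b 0.
    - by move: ab; rewrite ltNge mulr_le0.
    - by rewrite (ltW b0) orbT.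
    - by rewrite (ltW a0).
    - by move: ab; rewrite ltNge mulr_ge0 ?ltW.
  rewrite in_itv/= => /andP[ax xb]; exists x => _; split => //.
  rewrite !lt_neqAle ax xb !andbT; apply/andP; split; apply/eqP => xE.
    by move: jS; rewrite xE fx0 mul0r ltxx.
  by move: jS; rewrite -xE fx0 mulr0 ltxx.
have [g gP] := choice key.
have g2 j : j \in sign_changes f m -> 0 <= g j < 2 * pi.
  move=> jS; have [/andP[a b] _] := gP j jS.
  have m0 : (0 < m)%N by rewrite (leq_ltn_trans _ (ltn_ord j)).
  rewrite (le_trans _ (ltW a)) -?(grid0 m) ?grid_le//= (lt_le_trans b)//.
  by rewrite -(gridm m0) grid_le.
apply: (card_le_counting (g := h \o g)) => [i j iS jS /= hij|j jS /=]; last first.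
  by apply: hA; [exact: g2|have [] := gP j jS].
have gij : g i = g j by apply: hinj hij; exact: g2.
have m0 : (0 < m)%N by rewrite (leq_ltn_trans _ (ltn_ord j)).
have [/andP[a b] _] := gP i iS; have [/andP[a' b'] _] := gP j jS.
rewrite gij in a b.
apply/val_inj/eqP; rewrite eqn_leq -ltnS -(grid_lt _ _ m0) (lt_trans a b')/=.
by rewrite -ltnS -(grid_lt _ _ m0) (lt_trans a' b).
Qed.

(** Once the mesh is below the radius of [simple_zero_sign] at a root, the cell of that root
    contains no other zero, and its ends carry opposite signs unless the root is the left end. As B
    is finite, one mesh serves all its elements. *)
Lemma fset_le_weak_sign_changes {T : choiceType} f df (h : R -> T) (B : {fset T}) :
  (forall t : R, is_derive t 1 f (df t)) ->
  (forall b, b \in B -> exists2 x, 0 <= x < 2 * pi &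
     [/\ f x = 0, df x != 0 & h x = b]) ->
  \forall m \near \oo, (#|` B| <= #|weak_sign_changes f m|)%N.
Proof.
move=> fdf hB; have pi0 : 0 < 2 * pi :> R by rewrite mulr_gt0// pi_gt0.
have key b : exists xN : R * nat, b \in B ->
    [/\ 0 <= xN.1 < 2 * pi, f xN.1 = 0, h xN.1 = b &
    forall m, (xN.2 <= m)%N -> (0 < m)%N -> forall y, y != xN.1 ->
      `|y - xN.1| <= 2 * pi / m%:R -> 0 < f y * (y - xN.1) * df xN.1].
  have [bB|bB] := boolP (b \in B); last by exists (0, 0%N).
  have [x x2 [fx dfx hx]] := hB b bB.
  have [e e0 he] := simple_zero_sign fdf fx dfx.
  exists (x, (Num.truncn (2 * pi / e)).+1) => _; split => // m Nm m0 y yx yxm.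
  apply: he => //; apply: (le_lt_trans yxm).
  rewrite ltr_pdivrMr ?ltr0n// (mulrC e) -ltr_pdivrMr//.
  have /truncn_itv/andP[_ h1] : 0 <= 2 * pi / e by rewrite divr_ge0// ltW.
  by apply: (lt_le_trans h1); rewrite ler_nat.
have [g gP] := choice key.
pose N := (\max_(b <- enum_fset B) (g b).2).+1.
exists N => // m /= Nm; have m0 : (0 < m)%N by rewrite (leq_trans _ Nm).
have Nb b : b \in B -> ((g b).2 <= m)%N.
  move=> bB; rewrite (leq_trans _ (ltnW Nm))//.
  exact: (leq_bigmax_seq (F := fun b => (g b).2)).
have cell b : exists j : 'I_m, b \in B -> grid m j <= (g b).1 < grid m j.+1.
  have [bB|bB] := boolP (b \in B); last by exists (Ordinal m0).
  have [x2 _ _ _] := gP b bB; have [j jm jx] := grid_cell m0 x2.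
  by exists (Ordinal jm).
have [c cP] := choice cell.
rewrite -(size_map c) cardE; apply: uniq_leq_size.
  rewrite map_inj_in_uniq ?enum_fset_uniq// => b b' bB b'B cbb'.
  have [_ fb hb sb] := gP b bB; have [_ fb' hb' _] := gP b' b'B.
  rewrite -hb -hb'; congr h; apply/eqP; apply/negPn/negP => neq.
  have := sb m (Nb b bB) m0 (g b').1; rewrite eq_sym neq fb' !mul0r ltxx => /(_ isT) hf.
  suff /hf : `|(g b').1 - (g b).1| <= 2 * pi / m%:R by [].
  have := cP b bB; have := cP b' b'B; rewrite cbb' gridS ler_norml; lra.
move=> _ /mapP[b bB ->]; rewrite mem_enum inE.
have [_ fb _ sb] := gP b bB; have /andP[gl gr] := cP b bB.
have {}sb := sb m (Nb b bB) m0.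
move: gl; rewrite le_eqVlt => /orP[/eqP ->|gl]; first by rewrite fb mul0r.
have := sb (grid m (c b)); rewrite lt_eqF// => /(_ isT).
have := sb (grid m (c b).+1); rewrite gt_eqF// => /(_ isT).
have dr : `|grid m (c b).+1 - (g b).1| <= 2 * pi / m%:R.
  by move: gr gl; rewrite gridS ler_norml; lra.
have dl : `|grid m (c b) - (g b).1| <= 2 * pi / m%:R.
  by move: gr gl; rewrite gridS ler_norml; lra.
move=> /(_ dr) hr /(_ dl) hl.
(* The root lies strictly between the ends, so its differences with them have opposite signs; the
   positive product of [hr] and [hl] then contradicts a positive product of the two values of f. *)
have := mulr_gt0 hr hl; set u := f _; set v := f _.
set x := (g b).1 in gl gr *; set p := grid _ _; set q := grid _ _ => h1.
rewrite leNgt; apply/negP => uv.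
have d0 : 0 < df x ^+ 2.
  rewrite lt_neqAle sqr_ge0 andbT eq_sym sqrf_eq0.
  by apply: contraTN hr => /eqP ->; rewrite mulr0 ltxx.
have : 0 < (v * u) * df x ^+ 2 * ((p - x) * (x - q)).
  by apply: mulr_gt0; [apply: mulr_gt0|apply: mulr_gt0; rewrite subr_gt0].
move: h1; rewrite (_ : _ * _ = - ((v * u) * df x ^+ 2 * ((p - x) * (x - q)))).
  by rewrite oppr_gt0 => /lt_gtF ->.
by ring.
Qed.

End Grid.

(** * The unit circle and its angle *)

Section Circle.
Context {R : realType}.

Lemma Re_sum (I : Type) (s : seq I) (F : I -> R[i]) :
  complex.Re (\sum_(i <- s) F i) = \sum_(i <- s) complex.Re (F i).
Proof.
elim: s => [|x s IH]; first by rewrite !big_nil.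
by rewrite !big_cons -IH; case: (F x) (\sum_(_ <- _) _) => a b [].
Qed.

Lemma Im_sum (I : Type) (s : seq I) (F : I -> R[i]) :
  complex.Im (\sum_(i <- s) F i) = \sum_(i <- s) complex.Im (F i).
Proof.
elim: s => [|x s IH]; first by rewrite !big_nil.
by rewrite !big_cons -IH; case: (F x) (\sum_(_ <- _) _) => a b [].
Qed.

Lemma expiD (s t : R) : expi (s + t) = expi s * expi t.
Proof. by rewrite /expi cosD sinD; congr Complex; ring. Qed.

Lemma expi0 : expi (0 : R) = 1.
Proof. by rewrite /expi cos0 sin0. Qed.

Lemma expi_neq0 (t : R) : expi t != 0.
Proof.
apply/eqP => h; have := expiD t (- t); rewrite subrr expi0 h mul0r.
by move/eqP; rewrite oner_eq0.
Qed.

Lemma expiN (t : R) : expi (- t) = (expi t)^-1.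
Proof.
apply: (mulfI (expi_neq0 t)); rewrite -expiD subrr expi0 divff//.
exact: expi_neq0.
Qed.

Lemma expiX (l : int) (t : R) : expi t ^ l = expi (l%:~R * t).
Proof.
have expin (n : nat) : expi t ^+ n = expi (n%:R * t).
  elim: n => [|n IH]; first by rewrite expr0 mul0r expi0.
  by rewrite exprS IH -expiD -{1}[t]mul1r -mulrDl nat1r.
case: l => n; first by rewrite -pmulrn -exprnP expin.
rewrite NegzE -exprnN expin -expiN; congr expi.
by rewrite mulrNz mulNr.
Qed.

Lemma conj_expi (t : R) : (expi t)^*%C = expi (- t).
Proof. by rewrite /expi cosN sinN. Qed.

Lemma norm_expi (t : R) : `|expi t| = 1.
Proof. by rewrite normc_def /expi/= cos2Dsin2 sqrtr1. Qed.

(** 1 - cos t = 2 sin^2 (t / 2), and the sine is positive for 0 < t < 2 pi. *)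
Lemma cos_eq1 (t : R) : - (2 * pi) < t < 2 * pi -> cos t = 1 -> t = 0.
Proof.
wlog t0 : t / 0 <= t => [hw /andP[t1 t2] ct|].
  have [t0|t0] := leP 0 t; first by apply: hw => //; rewrite t1.
  have := hw (- t); rewrite cosN oppr_ge0 (ltW t0) ltrN2 t2/= ltrNl t1/= => /(_ isT isT ct).
  by move/eqP; rewrite oppr_eq0 => /eqP.
move=> /andP[_ t2] ct; apply/eqP; apply: contraT => tn0.
have tp : 0 < t by rewrite lt_neqAle eq_sym tn0.
have : 0 < sin (t / 2).
  by apply: sin_gt0_pi; rewrite divr_gt0//= ltr_pdivrMr// mulrC.
have := cos_mulr2n (t / 2); rewrite -[(t / 2) *+ 2]mulr_natr divfK// ct cos2sin2 => h.
suff -> : sin (t / 2) = 0 by rewrite ltxx.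
by apply/eqP; rewrite -sqrf_eq0; apply/eqP; lra.
Qed.

Lemma expi_inj (x y : R) : 0 <= x < 2 * pi -> 0 <= y < 2 * pi ->
  expi x = expi y -> x = y.
Proof.
move=> /andP[x0 x2] /andP[y0 y2] [hc hs].
apply/eqP; rewrite -subr_eq0; apply/eqP/cos_eq1; first by apply/andP; split; lra.
by rewrite cosB hc hs -!expr2 cos2Dsin2.
Qed.

Lemma expi_surj (z : R[i]) : `|z| = 1 -> exists2 t, 0 <= t < 2 * pi & expi t = z.
Proof.
case: z => a b; rewrite normc_def/= => -[/(congr1 (fun x => x ^+ 2))].
rewrite expr1n sqr_sqrtr ?addr_ge0 ?sqr_ge0// => ab.
have pi0 := pi_gt0 R.
have aint : -1 <= a <= 1.
  have : a ^+ 2 <= 1 by rewrite -ab lerDl sqr_ge0.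
  by move=> h; rewrite -ler_norml -ler_sqr ?nnegrE// expr1n real_normK// num_real.
have sE : sin (acos a) = `|b|.
  by rewrite sin_acos// -ab addrAC subrr add0r sqrtr_sqr.
have ca : cos (acos a) = a by rewrite acosK// in_itv.
have a0 := acos_ge0 aint; have api := acos_lepi aint.
have [b0|b0] := leP 0 b.
  exists (acos a); first by rewrite a0/=; lra.
  by rewrite /expi ca sE ger0_norm.
have acos_gt : 0 < acos a.
  rewrite lt_neqAle a0 andbT; apply/eqP => a00; move: sE.
  by rewrite -a00 sin0 => /esym/eqP; rewrite normr_eq0 lt_eqF.
exists (2 * pi - acos a); first by apply/andP; split; lra.
have -> : 2 * pi - acos a = - acos a + pi *+ 2 by rewrite addrC mulr_natl.
by rewrite /expi cosD2pi sinD2pi cosN sinN ca sE ltr0_norm// opprK.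
Qed.

End Circle.

Section Laurent.
Context {R : realType} (L : {fset int}).

Lemma laurent_trigp (a : int -> R[i]) (t : R) :
  complex.Re (laurent L a (expi t)) =
  trigp L (fun l => complex.Re (a l)) (fun l => - complex.Im (a l)) t.
Proof.
rewrite /laurent Re_sum; apply: eq_bigr => l _; rewrite expiX /expi.
by case: (a l) => x y /=; ring.
Qed.

Lemma real_rootsE (a : int -> R[i]) (f : R -> R) :
  (forall t, laurent L a (expi t) = (f t)%:C%C) ->
  real_roots L a = @expi R @` [set t | 0 <= t < 2 * pi /\ f t = 0].
Proof.
move=> fE; apply/seteqP; split => [z [/expi_surj[t t2 <-]]|_ [t [t2 ft] <-]].
  by rewrite fE => -[ft]; exists t.
by split; [exact: norm_expi|rewrite fE ft].
Qed.

End Laurent.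

Lemma continuous_bigsum {R : realType} (T : Type) (s : seq T) (f : T -> R -> R) :
  (forall i, continuous (f i)) -> continuous (fun t => \sum_(i <- s) f i t).
Proof.
move=> cf; elim: s => [|x s IH].
  rewrite (_ : (fun t => _) = cst 0); first by move=> t; exact: cvg_cst.
  by apply/funext => t; rewrite big_nil.
rewrite (_ : (fun t => _) = f x \+ (fun t => \sum_(i <- s) f i t)).
  by move=> t; apply: continuousD; [exact: cf|exact: IH].
by apply/funext => t; rewrite big_cons.
Qed.

(** * The reproducing kernel *)

Section DotProduct.
Context {R : realType}.
Local Notation mu := (@lebesgue_measure R).
Local Notation I0 := (`[0, 2 * pi : R]%classic).

Lemma continuous_integrable_period (f : R -> R) : continuous f ->
  mu.-integrable I0 (EFin \o f).
Proof.
move=> cf; apply: continuous_compact_integrable; first exact: segment_compact.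
exact: continuous_subspaceT.
Qed.

Lemma dotC (f g : R -> R) : dot f g = dot g f.
Proof. by congr (_ * _); apply: eq_Rintegral => t _; rewrite mulrC. Qed.

Lemma dotDl (f1 f2 g : R -> R) : continuous f1 -> continuous f2 -> continuous g ->
  dot (fun t => f1 t + f2 t) g = dot f1 g + dot f2 g.
Proof.
move=> c1 c2 cg; rewrite /dot -mulrDr -RintegralD//.
- by congr (_ * _); apply: eq_Rintegral => t _; rewrite mulrDl.
- by apply: continuous_integrable_period => t; apply: continuousM; [exact: c1|exact: cg].
- by apply: continuous_integrable_period => t; apply: continuousM; [exact: c2|exact: cg].
Qed.

Lemma dotZl (k : R) (f g : R -> R) : continuous f -> continuous g ->
  dot (fun t => k * f t) g = k * dot f g.
Proof.
move=> cf cg; rewrite /dot [RHS]mulrCA; congr (_ * _); rewrite -RintegralZl//.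
  by apply: eq_Rintegral => t _; rewrite mulrA.
by apply: continuous_integrable_period => t; apply: continuousM; [exact: cf|exact: cg].
Qed.

Lemma dot_suml (T : Type) (s : seq T) (f : T -> R -> R) (g : R -> R) :
  (forall i, continuous (f i)) -> continuous g ->
  dot (fun t => \sum_(i <- s) f i t) g = \sum_(i <- s) dot (f i) g.
Proof.
move=> cf cg; elim: s => [|x s IH].
  rewrite big_nil /dot; under eq_Rintegral do rewrite big_nil mul0r.
  by rewrite Rintegral_cst//= mul0r mulr0.
rewrite big_cons -IH -dotDl//.
  by congr (dot _ g); apply/funext => t; rewrite big_cons.
exact: continuous_bigsum.
Qed.

(** For k nonzero the antiderivative sin (k t + x) / k takes the same value at 0 and 2 pi. The phase
    x makes the formula serve sines too. *)
Lemma dot_cos (k : int) (x : R) :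
  dot (fun t => cos (k%:~R * t + x)) (fun=> 1) = (k == 0)%:R * cos x.
Proof.
have pi0 : 0 < 2 * pi :> R by rewrite mulr_gt0// pi_gt0.
rewrite /dot; have [->|k0] := eqVneq k 0.
  under eq_Rintegral do rewrite mulr1 mul0r add0r.
  rewrite Rintegral_cst//= lebesgue_measure_itv/= lte_fin pi0 -EFinB/= subr0.
  by rewrite mulrCA mulVf ?gt_eqF// mulr1 mul1r.
rewrite mul0r.
have kR0 : (k%:~R : R) != 0 by rewrite intr_eq0.
pose F (t : R) : R := k%:~R^-1 * sin (k%:~R * t + x).
have dF t : is_derive t (1 : R) F (cos (k%:~R * t + x)).
  have dl : is_derive t (1 : R) (fun t : R => k%:~R * t + x) (k%:~R).
    have h := @is_deriveZ _ _ _ _ (k%:~R : R) _ _ _ (@is_derive_id _ R t 1).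
    have := is_deriveD h (@is_derive_cst _ _ _ x t 1).
    by rewrite /GRing.scale/= mulr1 addr0.
  have := @is_deriveZ _ _ _ _ (k%:~R^-1 : R) _ _ _ (is_derive1_comp (is_derive_sin _) dl).
  by rewrite /GRing.scale/= mulrCA mulVf// mulr1.
have cF : continuous F.
  by move=> t; apply: differentiable_continuous; apply/derivable1_diffP; have [] := dF t.
have cc : continuous (fun t : R => cos (k%:~R * t + x)).
  move=> t; apply: continuous_comp; last exact: continuous_cos.
  by apply: continuousD; [exact: mulrl_continuous|exact: cvg_cst].
rewrite /Rintegral; under eq_integral do rewrite mulr1.
rewrite (@continuous_FTC2 _ (fun t : R => cos (k%:~R * t + x)) F)//.
- suff -> : F (2 * pi) = F 0 by rewrite -EFinB subrr mulr0.
  rewrite /F; congr (_ * _); rewrite mulr0 add0r.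
  (* Raising this equality to the power k gives the cosine and sine of 2 pi k at once, for k of
     either sign. *)
  have : expi (2 * pi) = expi 0 :> R[i].
    rewrite expi0 /expi; have -> : 2 * pi = pi *+ 2 :> R by rewrite mulr_natl.
    by rewrite cos2pi sin2pi.
  move/(congr1 (fun z => z ^ k)); rewrite !expiX mulr0 /expi cos0 sin0 => -[h1 h2].
  by rewrite sinD h1 h2 mul0r mul1r add0r.
- exact: continuous_subspaceT.
- split.
  + by move=> t _; have [] := dF t.
  + by apply: cvg_at_right_filter; exact: cF.
  + by apply: cvg_at_left_filter; exact: cF.
- by move=> t _; rewrite derive1E; have [_ ->] := dF t.
Qed.

Lemma continuous_cos_affine (k x : R) : continuous (fun t : R => cos (k * t + x)).
Proof.
move=> t; apply: continuous_comp; last exact: continuous_cos.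
by apply: continuousD; [exact: mulrl_continuous|exact: cvg_cst].
Qed.

Lemma dot_cos_cos (l m : int) (x y : R) :
  dot (fun t => cos (l%:~R * t + x)) (fun t => cos (m%:~R * t + y)) =
  2^-1 * ((l == - m)%:R * cos (x + y) + (l == m)%:R * cos (x - y)).
Proof.
have -> : dot (fun t => cos (l%:~R * t + x)) (fun t => cos (m%:~R * t + y)) =
   2^-1 * dot (fun t => cos ((l + m)%:~R * t + (x + y)) +
              cos ((l - m)%:~R * t + (x - y))) (fun=> 1).
  rewrite -dotZl; first last.
  - by move=> t; exact: cvg_cst.
  - by move=> t; apply: continuousD; exact: continuous_cos_affine.
  congr (_ * _); apply: eq_Rintegral => t _; rewrite mulr1.
  rewrite intrD intrB.
  have -> : (l%:~R + m%:~R) * t + (x + y) = (l%:~R * t + x) + (m%:~R * t + y) by ring.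
  have -> : (l%:~R - m%:~R) * t + (x - y) = (l%:~R * t + x) - (m%:~R * t + y) by ring.
  move: (l%:~R * t + x) (m%:~R * t + y) => A B.
  by rewrite (cosB A B) (cosD A B); field.
rewrite dotDl; [|exact: continuous_cos_affine|exact: continuous_cos_affine|];
  last by move=> t; exact: cvg_cst.
by rewrite !dot_cos addr_eq0 subr_eq0.
Qed.

End DotProduct.

Section ReproducingKernel.
Context {R : realType} (L : {fset int}).
Hypothesis L_sym : forall l, l \in L -> - l \in L.

Lemma sum_pick (A : {fset int}) (m : int) (F : int -> R) : m \in A ->
  \sum_(l <- A) (l == m)%:R * F l = F m.
Proof.
move=> mA; rewrite (bigD1_seq m mA (fset_uniq A)) eqxx mul1r big1_seq/= ?addr0//.
by move=> i /andP[/negbTE ->]; rewrite mul0r.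
Qed.

Lemma sum_oppr (V : nmodType) (F : int -> V) :
  \sum_(l <- L) F (- l) = \sum_(l <- L) F l.
Proof.
rewrite -(big_map -%R predT F); apply: perm_big; apply: uniq_perm.
- by rewrite (map_inj_uniq oppr_inj) fset_uniq.
- exact: fset_uniq.
- move=> l; apply/mapP/idP => [[m mL ->]|lL]; first exact: L_sym.
  by exists (- l); [exact: L_sym|rewrite opprK].
Qed.

(** The Dirichlet kernel of the spectrum at t - s, written as a frequency in t plus a phase to match
    [dot_cos_cos]. *)
Definition kernel (s t : R) : R := \sum_(l <- L) cos (l%:~R * t + - (l%:~R * s)).

(** The frequencies m and - m of the kernel contribute half the value each; for m = 0 the single
    frequency counts twice. *)
Lemma dot_kernel_cos (s : R) (m : int) (y : R) : m \in L ->
  dot (kernel s) (fun t => cos (m%:~R * t + y)) = cos (m%:~R * s + y).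
Proof.
move=> mL; rewrite dot_suml; first last.
- exact: continuous_cos_affine.
- by move=> l; exact: continuous_cos_affine.
under eq_bigr do rewrite dot_cos_cos.
rewrite -big_distrr/= big_split/=.
rewrite (@sum_pick _ (- m) (fun l => cos (- (l%:~R * s) + y))) ?L_sym//.
rewrite (@sum_pick _ m (fun l => cos (- (l%:~R * s) - y)))//.
by rewrite mulrNz mulNr opprK -opprD cosN; move: (cos _) => c; field.
Qed.

Lemma Trig_trigp (f : R -> R) : Trig L f -> exists p r, f = trigp L p r.
Proof.
move=> [a [_ fE]]; exists (fun l => complex.Re (a l)), (fun l => - complex.Im (a l)).
by apply/funext => t; rewrite -laurent_trigp -fE.
Qed.

Lemma Trig_continuous (f : R -> R) : Trig L f -> continuous f.
Proof. by move=> /Trig_trigp[p [r ->]]; exact: trigp_continuous. Qed.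

Lemma continuous_kernel s : continuous (kernel s).
Proof.
by apply: continuous_bigsum => l; exact: continuous_cos_affine.
Qed.

(** Linearity reduces this to [dot_kernel_cos], a sine being a cosine of phase - pi / 2. *)
Lemma dot_kernel (f : R -> R) (s : R) : Trig L f -> dot (kernel s) f = f s.
Proof.
move=> /Trig_trigp[p [r ->]]; rewrite dotC.
have sE (x : R) : sin x = cos (x + - (pi / 2)) by rewrite cosBpihalf.
pose g l t := p l * cos (l%:~R * t + 0) + r l * cos (l%:~R * t + - (pi / 2)).
have -> : trigp L p r = (fun t => \sum_(l <- L) g l t).
  by apply/funext => t; apply: eq_bigr => l _; rewrite /g addr0 sE.
have cc l y : continuous (fun t : R => cos (l%:~R * t + y)).
  exact: continuous_cos_affine.
have cM (k : R) l y : continuous (fun t : R => k * cos (l%:~R * t + y)).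
  by move=> t; apply: continuousM; [exact: cvg_cst|exact: cc].
have cg l : continuous
    (fun t : R => p l * cos (l%:~R * t + 0) + r l * cos (l%:~R * t + - (pi / 2))).
  by move=> t; exact: (cvgD (cM (p l) l 0 t) (cM (r l) l (- (pi / 2)) t)).
rewrite dot_suml; last 2 first.
- exact: cg.
- exact: continuous_kernel.
rewrite !big_seq; apply: eq_bigr => l lL.
have ck := @continuous_kernel s.
rewrite dotDl// !dotZl// dotC dot_kernel_cos// dotC dot_kernel_cos//.
Qed.

Lemma laurent_kernel (s t : R) :
  laurent L (fun l => expi (- (l%:~R * s))) (expi t) = (kernel s t)%:C%C.
Proof.
rewrite /laurent; under eq_bigr do rewrite expiX -expiD addrC.
set S := \sum_(_ <- _) _.
have ReS : complex.Re S = kernel s t by rewrite Re_sum.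
have ImS : complex.Im S = 0.
  rewrite Im_sum/=; set I := \sum_(_ <- _) _.
  have : I = - I.
    rewrite {1}/I -sum_oppr -sumrN; apply: eq_bigr => l _.
    by rewrite mulrNz !mulNr -opprD sinN.
  by lra.
by case: S ReS ImS => x y /= -> ->.
Qed.

Lemma Trig_kernel (s : R) : Trig L (kernel s).
Proof.
exists (fun l => expi (- (l%:~R * s))); split => [l _|t].
  by rewrite conj_expi mulrNz mulNr.
by rewrite laurent_kernel.
Qed.

(** The coordinates of [kernel s] in the basis are the e i s, by the reproducing property. The left
    side is the covariance of f(s) and f(t), which is thus independent of the basis. *)
Lemma orthonormal_basis_kernel (e : 'I_#|` L| -> R -> R) (s t : R) :
  orthonormal_basis e -> \sum_i e i s * e i t = kernel s t.
Proof.
move=> [eT eO eB]; have [c cE] := eB _ (Trig_kernel s).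
have ce i : continuous (e i) := Trig_continuous (eT i).
rewrite cE; apply: eq_bigr => i _; congr (_ * _).
rewrite -(dot_kernel s (eT i)).
have -> : kernel s = (fun t => \sum_i c i * e i t) by apply/funext.
rewrite dot_suml//; last first.
  by move=> j u; apply: continuousM; [exact: cvg_cst|exact: ce].
rewrite (bigD1 i)//= dotZl// eO eqxx mulr1 big1 ?addr0// => j ji.
by rewrite dotZl// eO (negbTE ji) mulr0.
Qed.

Lemma kernel_diag (t : R) : kernel t t = #|` L|%:R.
Proof.
rewrite /kernel; under eq_bigr do rewrite subrr cos0.
by rewrite big_const_seq count_predT iter_addr_0.
Qed.

End ReproducingKernel.

(** * Coefficients and number of complex roots *)

Lemma mup_prod_XsubC (F : fieldType) (x : F) (r : seq F) :
  mup x (\prod_(z <- r) ('X - z%:P)) = count_mem x r.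
Proof.
elim: r => [|z r IH]; first by rewrite big_nil mupNroot// root1.
rewrite big_cons mupM ?polyXsubC_eq0//; last first.
  by rewrite monic_neq0// monic_prod_XsubC.
by rewrite IH -['X - _]expr1 mup_XsubCX /=; case: eqP.
Qed.

(** The polynomial splits, and its nonzero constant coefficient keeps 0 from being a root, so no
    root is left out of the sum. *)
Lemma sum_mup_neq0 (F : closedFieldType) (p : {poly F}) : p`_0 != 0 ->
  (\sum_(z \in [set z : F | z != 0%R]) mup z p)%N = (size p).-1.
Proof.
move=> p00; have p0 : p != 0 by apply: contraNneq p00 => ->; rewrite coef0.
have [r rE] := closed_field_poly_normal p.
have lc0 : lead_coef p != 0 by rewrite lead_coef_eq0.
have mupE z : mup z p = count_mem z r.
  rewrite rE -mul_polyC mupMr ?mup_prod_XsubC// rootC//.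
have sizeE : size p = (size r).+1.
  by rewrite rE size_scale// size_prod_XsubC.
have r0 z : z \in r -> z != 0.
  move=> zr; apply/eqP => z0.
  have : root p z by rewrite rE rootZ// root_prod_XsubC.
  by rewrite z0 /root horner_coef0 (negbTE p00).
rewrite sizeE/= (fsbigE (undup r)) ?undup_uniq//.
- transitivity (\sum_(z <- undup r) mup z p)%N.
    rewrite [LHS]big_seq_cond [RHS]big_seq; apply: eq_bigl => z.
    apply/andP/idP => [[]//|zr]; split=> //; apply/mem_set/r0.
    by rewrite -mem_undup.
  rewrite -sum1_size -[RHS]big_undup_iterop_count; apply: eq_bigr => z _.
  by rewrite mupE Monoid.iteropE iter_addn mul1n addn0.
- by move=> z /=; rewrite mem_undup => /r0.
- by move=> z _; rewrite mem_undup mupE => /count_memPn.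
Qed.

Section LaurentCoef.
Context {R : realType} (L : {fset int}).
Local Notation D := (degree L).

Lemma le_degree (l : int) : l \in L -> (`|l| <= D)%N.
Proof. by move=> lL; exact: (leq_bigmax_seq (F := fun l : int => `|l|%N)). Qed.

Lemma addz_degree_ge0 (l : int) : l \in L -> (0 <= l + D%:Z)%R.
Proof.
move=> /le_degree lD; have : - l <= `|l|%N%:Z by rewrite abszE -normrN ler_norm.
have : (`|l|%N%:Z <= D%:Z)%R by rewrite lez_nat.
lia.
Qed.

Lemma coef_laurent_poly (a : int -> R[i]) (l : int) : l \in L ->
  (laurent_poly L a)`_(absz (l + D%:Z)) = a l.
Proof.
move=> lL; rewrite /laurent_poly coef_sum.
rewrite (bigD1_seq l lL (fset_uniq L)) coefZ coefXn eqxx mulr1 big1_seq/= ?addr0//.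
move=> m /andP[ml mL]; rewrite coefZ coefXn.
case: eqP => [h|_]; last by rewrite mulr0.
have := addz_degree_ge0 lL; have := addz_degree_ge0 mL.
move=> m0 l0; case/eqP: ml; lia.
Qed.

Lemma size_laurent_poly (a : int -> R[i]) : (size (laurent_poly L a) <= (D + D).+1)%N.
Proof.
apply: (leq_trans (size_sum _ _ _)); apply/bigmax_leqP_seq => l lL _.
apply: (leq_trans (size_scale_leq _ _)); rewrite size_polyXn ltnS.
have := le_degree lL; lia.
Qed.

Lemma laurent_polyE (a : int -> R[i]) (z : R[i]) : z != 0 ->
  (laurent_poly L a).[z] = z ^+ D * laurent L a z.
Proof.
move=> z0; rewrite /laurent_poly /laurent horner_sum mulr_sumr !big_seq.
apply: eq_bigr => l lL; rewrite hornerZ hornerXn mulrCA; congr (_ * _).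
rewrite !exprnP -expfzDr// [X in _ = z ^ X]addrC; congr (_ ^ _).
by rewrite gez0_abs// addz_degree_ge0.
Qed.

(** A random Laurent polynomial is specified only through its values on the circle; this recovers
    its coefficients. The polynomial of the difference vanishes at as many distinct points as its
    size, namely those of angles 1 / (n + 1). *)
Lemma laurent_inj (a b : int -> R[i]) :
  (forall t, laurent L a (expi t) = laurent L b (expi t)) ->
  forall l, l \in L -> a l = b l.
Proof.
move=> ab l lL; apply/eqP; rewrite -subr_eq0; apply/eqP.
pose c l := a l - b l.
have cE t : laurent L c (expi t) = 0.
  rewrite /laurent; under eq_bigr do rewrite mulrBl.
  by rewrite sumrB -/(laurent L a _) ab subrr.
suff c0 : laurent_poly L c = 0.
  by rewrite -/(c l) -(coef_laurent_poly c lL) c0 coef0.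
pose rs := [seq expi (n.+1%:R^-1 : R) | n <- iota 0 (size (laurent_poly L c))].
have V01 (n : nat) : 0 <= (n.+1%:R^-1 : R) < 2 * pi.
  rewrite invr_ge0 ler0n/= (@le_lt_trans _ _ 1)//.
    by rewrite invf_le1 ?ltr0n// ler1n.
  by have := pi_ge2 R; lra.
apply: (@roots_geq_poly_eq0 _ _ rs).
- apply/allP => _ /mapP[n _ ->]; rewrite /root laurent_polyE ?expi_neq0//.
  by rewrite cE mulr0.
- rewrite map_inj_uniq ?iota_uniq// => n m /(expi_inj (V01 n) (V01 m)).
  by move/invr_inj/eqP; rewrite eqr_nat => /eqP[].
- by rewrite size_map size_iota.
Qed.

(** The two extreme coefficients become the constant and the leading coefficient of
    [laurent_poly]. *)
Lemma root_count_degree (a : int -> R[i]) :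
  D%:Z \in L -> - D%:Z \in L -> a D%:Z != 0 -> a (- D%:Z) != 0 ->
  root_count L a = (2 * D)%N.
Proof.
move=> DL NDL aD aND.
have cD := coef_laurent_poly a DL; have cND := coef_laurent_poly a NDL.
rewrite addNr absz0 in cND; rewrite -PoszD absz_nat in cD.
rewrite /root_count sum_mup_neq0 ?cND//.
suff -> : size (laurent_poly L a) = (D + D).+1 by rewrite /= mul2n addnn.
apply/eqP; rewrite eqn_leq size_laurent_poly ltnNge; apply/negP => h.
by move: aD; rewrite -cD nth_default// eqxx.
Qed.

Lemma degree_mem (L_sym : forall l, l \in L -> - l \in L) : L != fset0 ->
  D%:Z \in L /\ - D%:Z \in L.
Proof.
case/fset0Pn => l0 l0L.
have [l lL lD] : exists2 l, l \in L & (`|l|)%N = D.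
  have := @bigop.eq_bigmax L (fun l => absz (val l)).
  rewrite -cardfE; have -> : (0 < #|` L|)%N by rewrite cardfs_gt0; apply/fset0Pn; exists l0.
  move=> /(_ isT)[i iE]; exists (val i); first exact: valP.
  by rewrite -iE /degree big_seq_fsetE.
have [lE|lE] : l = D%:Z \/ l = - D%:Z by lia.
  by rewrite -lE; split => //; exact: L_sym.
by split; rewrite -?lE// -[D%:Z]opprK -lE; exact: L_sym.
Qed.

Lemma degree_gt0 : L != fset0 -> L != [fset 0]%fset -> (0 < D)%N.
Proof.
move=> L0 L00; rewrite lt0n; apply: contra L00 => /eqP D0.
have L0' l : l \in L -> l = 0.
  by move=> /le_degree; rewrite D0 leqn0 absz_eq0 => /eqP.
apply/eqP/fsetP => l; rewrite inE; apply/idP/eqP => [/L0'//|->].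
by case/fset0Pn: L0 => x xL; rewrite -(L0' x xL).
Qed.

End LaurentCoef.

(** * Expected number of real roots *)

(* The number of real roots is not known to be a measurable function, but the
   integral of a nonnegative function is the supremum of the integrals of the
   simple functions below it, measurable or not. *)
Section NonMeasurableIntegrand.
Context (d : measure_display) (T : measurableType d) (R : realType).
Variable mu : {measure set T -> \bar R}.
Local Open Scope ereal_scope.
Import HBNNSimple.

Lemma ge0_integral_mono (f g : T -> \bar R) : (forall x, 0 <= f x) ->
  (forall x, f x <= g x) -> \int[mu]_x f x <= \int[mu]_x g x.
Proof.
move=> f0 fg; have g0 x : 0 <= g x by exact: le_trans (fg x).
rewrite !ge0_integralTE//; apply: ereal_sup_le => _ [h /= hf <-].
by exists h => //= x; exact: le_trans (fg x).
Qed.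

Lemma ge0_integral_mono_ae (A : set T) (f g : T -> \bar R) :
  measurable A -> mu A = 0 -> (forall x, 0 <= f x) -> (forall x, 0 <= g x) ->
  measurable_fun [set: T] g -> (forall x, ~ A x -> f x <= g x) ->
  \int[mu]_x f x <= \int[mu]_x g x.
Proof.
move=> mA A0 f0 g0 mg fg; rewrite ge0_integralTE//.
apply: ge_ereal_sup => _ [h /= hf <-]; rewrite -integralT_nnsfun.
apply: ae_ge0_le_integral => //.
- by move=> x _; rewrite lee_fin.
- exact/measurable_EFinP.
- exists A; split => // x /= xA; apply: contrapT => nAx; apply: xA => _.
  by apply: (le_trans (hf x)); exact: fg.
Qed.

End NonMeasurableIntegrand.

Section CardExpectation.
Context (d : measure_display) (T : measurableType d) (R : realType).
Variables (P : probability T R) (m : nat) (S : T -> {set 'I_m}) (A : 'I_m -> set T).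
Hypotheses (SA : forall w j, (j \in S w) <-> A j w) (mA : forall j, measurable (A j)).
Local Open Scope ereal_scope.

Lemma card_indic w : #|S w|%:R%:E = \sum_(j < m) (\1_(A j) w)%:E :> \bar R.
Proof.
rewrite sumEFin; congr EFin; rewrite -sum1_card natr_sum big_mkcond/=.
apply: eq_bigr => j _; rewrite indicE.
case: ifPn => [/SA/mem_set -> //|jS].
by rewrite (_ : (w \in A j) = false)//; apply/negbTE; apply: contra jS => /set_mem/SA.
Qed.

Lemma measurable_card_indic : measurable_fun [set: T] (fun w => #|S w|%:R%:E : \bar R).
Proof.
rewrite (_ : (fun _ => _) = (fun w => \sum_(j < m) (\1_(A j) w)%:E)); last first.
  by apply/funext => w; exact: card_indic.
by apply: emeasurable_sum => j; apply/measurable_EFinP; exact: measurable_indic.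
Qed.

Lemma integral_card (c : R) : (forall j, P (A j) = c%:E) ->
  \int[P]_w #|S w|%:R%:E = (m%:R * c)%:E.
Proof.
move=> PA; rewrite (eq_integral (fun w => \sum_(j < m) (\1_(A j) w)%:E)); last first.
  by move=> w _; exact: card_indic.
rewrite ge0_integral_sum//; last first.
  by move=> j; apply/measurable_EFinP; exact: measurable_indic.
rewrite (eq_bigr (fun=> c%:E)); last first.
  by move=> j _; rewrite integral_indic// setIT; exact: PA.
by rewrite sumEFin sumr_const card_ord mulr_natl.
Qed.

End CardExpectation.

Section RandomTrig.
Context (d : measure_display) (T : measurableType d) (R : realType).
Variables (P : probability T R) (L : {fset int}).
Hypotheses (L_sym : forall l, l \in L -> - l \in L) (L_neq0 : L != fset0).
Variables (e : 'I_#|` L| -> R -> R) (X : 'I_#|` L| -> {RV P >-> R}).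
Hypotheses (eON : orthonormal_basis e).
Hypotheses (indX : independent_RVs X) (stdX : forall i, standard_normal (X i)).
Variable F : T -> int -> R[i].
Hypothesis FE : forall w t, laurent L (F w) (expi t) = (\sum_i X i w * e i t)%:C%C.

Local Notation N := (#|` L|%:R : R).
Local Notation f w t := (lincomb X (fun i => e i t) w).

Let N_gt0 : 0 < N.
Proof. by rewrite ltr0n cardfs_gt0. Qed.

Let laurentE w t : laurent L (F w) (expi t) = (f w t)%:C%C.
Proof. by rewrite FE; congr (_ _); apply: eq_bigr => i _; rewrite mulrC. Qed.

Let pw w (l : int) : R := complex.Re (F w l).
Let rw w (l : int) : R := - complex.Im (F w l).

Let f_trigp w : (fun t => f w t) = trigp L (pw w) (rw w).
Proof. by apply/funext => t; rewrite -laurent_trigp laurentE. Qed.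

Let var_f t : \sum_i e i t ^+ 2 = N.
Proof.
rewrite -(kernel_diag L t) -(orthonormal_basis_kernel L_sym t t eON).
by apply: eq_bigr => i _; rewrite expr2.
Qed.

Definition mesh_correlation m : R :=
  N^-1 * \sum_(l <- L) cos (l%:~R * (2 * pi / m%:R)).

Let cov_f m j :
  \sum_i e i (grid m j) * e i (grid m j.+1) = N * mesh_correlation m.
Proof.
rewrite (orthonormal_basis_kernel L_sym _ _ eON) /mesh_correlation.
rewrite mulrA mulfV ?gt_eqF// mul1r; apply: eq_bigr => l _; congr cos.
by rewrite gridS; ring.
Qed.

Lemma expectation_sign_changes m :
  (\int[P]_w #|sign_changes (fun t => f w t) m|%:R%:E =
   (m%:R * (acos (mesh_correlation m) / pi))%:E)%E.
Proof.
apply: (@integral_card _ _ _ P m _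
  (fun j => [set w | f w (grid m j) * f w (grid m j.+1) < 0])).
- by move=> w j; rewrite inE.
- by move=> j; apply: measurable_mul_lt0; exact: measurable_lincomb.
- by move=> j; apply: (lincomb_sign_change indX stdX N_gt0) => //; exact: cov_f.
Qed.

Let measurable_weak m j :
  measurable [set w | f w (grid m j) * f w (grid m j.+1) <= 0].
Proof. by apply: measurable_mul_le0; exact: measurable_lincomb. Qed.

Lemma expectation_weak_sign_changes m :
  (\int[P]_w #|weak_sign_changes (fun t => f w t) m|%:R%:E =
   (m%:R * (acos (mesh_correlation m) / pi))%:E)%E.
Proof.
apply: (@integral_card _ _ _ P m _
  (fun j => [set w | f w (grid m j) * f w (grid m j.+1) <= 0])).
- by move=> w j; rewrite inE.
- by move=> j; exact: measurable_weak.
- by move=> j; apply: (lincomb_sign_changeW indX stdX N_gt0) => //; exact: cov_f.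
Qed.

Let measurable_weak_count m : measurable_fun [set: T]
  (fun w => #|weak_sign_changes (fun t => f w t) m|%:R%:E : \bar R).
Proof.
apply: (@measurable_card_indic _ _ _ m _
  (fun j => [set w | f w (grid m j) * f w (grid m j.+1) <= 0])).
- by move=> w j; rewrite inE.
- by move=> j; exact: measurable_weak.
Qed.

(* With mesh 2 pi / m, a double root of f forces [near_small M m] as soon as M
   bounds the second derivative of f. *)
Let near_small (M m : nat) : set T := \big[setU/set0]_(j < m)
  [set w | `|f w (grid m j)| <= M%:R * (2 * pi / m%:R) ^+ 2].

Let measurable_small t (x : R) : measurable [set w | `|f w t| <= x].
Proof.
rewrite (_ : [set w | _] = lincomb X (fun i => e i t) @^-1` `[(- x), x]%classic).
  exact: measurable_lincomb_set.
by apply/funext => w; rewrite /= in_itv/= ler_norml.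
Qed.

Let measurable_near_small M m : measurable (near_small M m).
Proof. by apply: bigsetU_measurable => j _; exact: measurable_small. Qed.

Let P_near_small M m : (0 < m)%N ->
  (P (near_small M m) <= ((2 * (M%:R * (2 * pi) ^+ 2 / Num.sqrt N)) / m%:R)%:E)%E.
Proof.
move=> m0; have m0' : (0 : R) < m%:R by rewrite ltr0n.
pose A j := [set w | `|f w (grid m j)| <= M%:R * (2 * pi / m%:R) ^+ 2].
have := @Boole_inequality _ _ _ P A m (fun j _ => measurable_small _ _).
move/le_trans; apply.
pose c := 2 * (M%:R * (2 * pi / m%:R) ^+ 2 / Num.sqrt N).
apply: (@le_trans _ _ (\sum_(j < m) c%:E)%E).
  apply: lee_sum => j _; rewrite /c -(var_f (grid m j)).
  apply: (lincomb_small_ball indX stdX); first by rewrite var_f.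
  by rewrite mulr_ge0// sqr_ge0.
rewrite sumEFin lee_fin sumr_const card_ord -mulr_natl.
rewrite le_eqVlt; apply/orP; left; apply/eqP; rewrite /c.
move: (Num.sqrt _) (pi : R) => s p; rewrite expr_div_n.
have mn0 : m%:R != 0 :> R by rewrite gt_eqF.
by move: (s^-1) => s'; field.
Qed.

(** A measurable event containing every sample with a double root. The index M ranges over all
    integers because the second derivative is bounded only sample by sample. *)
Definition double_zero_null : set T :=
  \bigcup_M \bigcap_m near_small M m.+1.

Lemma measurable_double_zero_null : measurable double_zero_null.
Proof.
by apply: bigcupT_measurable => M; apply: bigcapT_measurable => m.
Qed.

Lemma P_double_zero_null : P double_zero_null = 0%E.
Proof.
have M0 M : P (\bigcap_m near_small M m.+1) = 0%E.
  have mI : measurable (\bigcap_m near_small M m.+1).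
    by apply: bigcapT_measurable => m.
  apply/eqP; rewrite eq_le measure_ge0 andbT; apply/lee_addgt0Pr => x x0.
  rewrite add0e.
  set c := 2 * (M%:R * (2 * pi) ^+ 2 / Num.sqrt N).
  have c0 : 0 <= c.
    by apply: mulr_ge0 => //; apply: divr_ge0 => //; apply: mulr_ge0 => //; exact: sqr_ge0.
  pose m := Num.truncn (c / x).
  apply: (@le_trans _ _ (P (near_small M m.+1))).
    by apply: le_measure; rewrite ?inE// => w; apply.
  apply: (le_trans (P_near_small _ _)) => //.
  rewrite lee_fin -/c ler_pdivrMr ?ltr0n// mulrC -ler_pdivrMr// ltW//.
  by have /truncn_itv/andP[] : 0 <= c / x by rewrite divr_ge0// ltW.
apply: (@negligibleP _ _ _ P _ measurable_double_zero_null).1.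
apply: negligible_bigcup => M.
apply/negligibleP; last exact: M0.
by apply: bigcapT_measurable => m.
Qed.

(** At a double root t, the grid point just left of t is closer than the mesh, so the quadratic
    bound, with M rounded up, puts the sample in [near_small] for every mesh. *)
Lemma not_double_zero_null w t : ~ double_zero_null w -> 0 <= t < 2 * pi ->
  f w t = 0 ->
  trigp L (fun l => l%:~R * rw w l) (fun l => - (l%:~R * pw w l)) t != 0.
Proof.
move=> nA t2 ft; apply/eqP => dft; apply: nA.
have [M M0 hM] := trigp_double_zero L (pw w) (rw w).
have ft' : trigp L (pw w) (rw w) t = 0 by rewrite -f_trigp.
exists (Num.truncn M).+1 => // m _.
have [j jm /andP[jt tj]] := grid_cell (ltn0Sn m) t2.
rewrite /near_small -(bigcup_mkord m.+1 (fun j => [set w |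
  `|f w (grid m.+1 j)| <= (Num.truncn M).+1%:R * (2 * pi / m.+1%:R) ^+ 2])).
exists j => //=.
have -> : f w (grid m.+1 j) = trigp L (pw w) (rw w) (grid m.+1 j) by rewrite -f_trigp.
apply: (le_trans (hM _ _ ft' dft)).
apply: ler_pM => //; first exact: sqr_ge0.
  by have /truncn_itv/andP[_ /ltW] := M0.
rewrite -(real_normK (num_real (grid m.+1 j - t))) lerXn2r ?nnegrE//.
  by rewrite divr_ge0// ltW// mulr_gt0// pi_gt0.
move: jt tj; rewrite gridS ler_norml.
by move: (2 * pi / m.+1%:R) => h; lra.
Qed.

Lemma expected_real_rootsE :
  expected_real_roots P L F = (2 * Num.sqrt (N^-1 * \sum_(l <- L) (l%:~R : R) ^+ 2))%:E.
Proof.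
have rootsE w : real_roots L (F w) = @expi R @` [set t | 0 <= t < 2 * pi /\ f w t = 0].
  by apply: real_rootsE => t; exact: laurentE.
set s := 2 * _.
have cvgs : (fun m => (m%:R * (acos (mesh_correlation m) / pi))%:E) @ \oo --> s%:E.
  apply: cvg_EFin; first by apply: nearW.
  by apply: cvg_angle_rms; rewrite cardfs_gt0.
apply/le_anti/andP; split; last first.
  rewrite -(cvg_lim _ cvgs)//; apply: lime_le; first by apply/cvg_ex; exists s%:E.
  apply: nearW => m; rewrite -expectation_sign_changes.
  apply: ge0_integral_mono => [w|w]; first by rewrite lee_fin.
  apply: (sign_changes_le_counting (h := @expi R)).
  - by rewrite f_trigp; exact: trigp_continuous.
  - by move=> x y x2 y2; exact: expi_inj.
  - by move=> x x2 fx; rewrite rootsE; exists x.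
(* Written as a lower limit of expectations of weak counts, the value is bounded below by Fatou;
   there remains the pointwise inequality outside the null event. *)
have -> : s%:E = limn_einf (fun m => (m%:R * (acos (mesh_correlation m) / pi))%:E).
  by have [->] := cvg_limn_einf_sup cvgs.
under eq_fun do rewrite -expectation_weak_sign_changes.
apply: le_trans (fatou _ _ _ _) => //.
apply: (@ge0_integral_mono_ae _ _ _ _ double_zero_null).
- exact: measurable_double_zero_null.
- exact: P_double_zero_null.
- by move=> w; rewrite /counting; case: ifPn => _; rewrite ?lee_fin ?leey.
- move=> w; rewrite limn_einf_lim; apply: lime_ge; first exact: is_cvg_einfs.
  apply: nearW => m; apply: le_ereal_inf_tmp => _ [k _ <-].
  by rewrite lee_fin.
- rewrite /limn_einf; apply: measurableT_comp => //.
  by apply: measurable_fun_limn_esup => m; apply: measurableT_comp.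
move=> w nA; apply: counting_le => B BA.
have fdf (t : R) : is_derive t 1 (fun t => f w t)
    (trigp L (fun l => l%:~R * rw w l) (fun l => - (l%:~R * pw w l)) t).
  by rewrite f_trigp; exact: is_derive_trigp.
have Bz b : b \in B -> exists2 x, 0 <= x < 2 * pi &
    [/\ f w x = 0, trigp L (fun l => l%:~R * rw w l) (fun l => - (l%:~R * pw w l)) x != 0
      & expi x = b].
  move=> /BA; rewrite rootsE => -[x [x2 fx] xb]; exists x => //; split => //.
  exact: not_double_zero_null.
have [n _ hn] := fset_le_weak_sign_changes fdf Bz.
rewrite limn_einf_lim.
(* From the index n on every weak count is at least the size of B, hence so is the infimum of that
   tail, and the lower limit is the supremum of the tail infima. *)
apply: (@le_trans _ _ (einfs (fun m =>
    #|weak_sign_changes (fun t => f w t) m|%:R%:E : \bar R) n)).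
  by apply: le_ereal_inf_tmp => _ [k /= nk <-]; rewrite lee_fin ler_nat; exact: hn.
rewrite (cvg_lim _ (@cvg_einfs_sup _ _))//.
by apply: ereal_sup_ubound; exists n.
Qed.

End RandomTrig.

(** * Almost sure number of complex roots *)

Section RootCount.
Context (d : measure_display) (T : measurableType d) (R : realType).
Variables (P : probability T R) (L : {fset int}).
Hypotheses (L_sym : forall l, l \in L -> - l \in L) (L_neq0 : L != fset0).
Variable F : T -> int -> R[i].
Hypothesis F_random : random_real_laurent P L F.
Local Notation D := (degree L).

Lemma Re_realM (x : R) (z : R[i]) : complex.Re (x%:C%C * z) = x * complex.Re z.
Proof. by case: z => a b /=; rewrite mul0r subr0. Qed.

Lemma Im_realM (x : R) (z : R[i]) : complex.Im (x%:C%C * z) = x * complex.Im z.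
Proof. by case: z => a b /=; rewrite mul0r addr0. Qed.

Lemma laurent_sum n (c : 'I_n -> R) (a : 'I_n -> int -> R[i]) (z : R[i]) :
  laurent L (fun l => \sum_i (c i)%:C%C * a i l) z =
  \sum_i (c i)%:C%C * laurent L (a i) z.
Proof.
rewrite /laurent; under [RHS]eq_bigr do rewrite mulr_sumr.
rewrite exchange_big/=; apply: eq_bigr => l _; rewrite mulr_suml.
by apply: eq_bigr => i _; rewrite mulrA.
Qed.

(** The coefficient of index D of the sample is the Gaussian combination of those of the basis
    elements. These do not all vanish, because [kernel 0], whose coefficient there is 1, lies in
    their span. The coefficient of index - D is the conjugate. *)
Lemma ae_root_count : {ae P, forall w, root_count L (F w) = (2 * D)%N}.
Proof.
have [e [X [eON indX stdX FE]]] := F_random.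
have [eT eO eB] := eON.
have [DL NDL] := degree_mem L_sym L_neq0.
have /choice[a aP] : forall i, exists a : int -> R[i],
     (forall l, l \in L -> a (- l) = (a l)^*%C) /\
     (forall t, (e i t)%:C%C = laurent L a (expi t)) by move=> i; exact: eT.
have expand n (c : 'I_n -> R) (b : 'I_n -> int -> R[i]) (g : 'I_n -> R -> R) t :
    (forall i, (g i t)%:C%C = laurent L (b i) (expi t)) ->
    (\sum_i c i * g i t)%:C%C = laurent L (fun l => \sum_i (c i)%:C%C * b i l) (expi t).
  move=> gb; rewrite laurent_sum rmorph_sum/=; apply: eq_bigr => i _.
  by rewrite rmorphM/= gb.
have FwE w l : l \in L -> F w l = \sum_i (X i w)%:C%C * a i l.
  move=> lL; apply: (laurent_inj (L := L) (a := F w)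
    (b := fun l => \sum_i (X i w)%:C%C * a i l)) => // t.
  by rewrite FE; apply: (expand _ (fun i => X i w) a e) => j; case: (aP j).
have [i ai0] : exists i, a i D%:Z != 0.
  apply/not_existsP => a0.
  have [c cE] := eB _ (Trig_kernel L_sym 0).
  suff : expi (- (D%:Z%:~R * 0)) = 0 :> R[i] by apply/eqP; exact: expi_neq0.
  transitivity (\sum_i (c i)%:C%C * a i D%:Z).
    apply: (laurent_inj (L := L) (a := fun l : int => expi (- (l%:~R * 0)))
      (b := fun l => \sum_i (c i)%:C%C * a i l)) => // t.
    rewrite laurent_kernel// cE.
    by apply: (expand _ c a e) => j; case: (aP j).
  rewrite big1// => j _; have /negP := a0 j.
  by rewrite negbK => /eqP ->; rewrite mulr0.
pose u i := complex.Re (a i D%:Z); pose v i := complex.Im (a i D%:Z).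
(* The complex coefficient vanishes only if both parts do, so it is enough that one of the two forms
   be nontrivial. *)
pose A := [set w | lincomb X u w = 0] `&` [set w | lincomb X v w = 0].
have FwD w : F w D%:Z = Complex (lincomb X u w) (lincomb X v w).
  apply/eqP; rewrite FwE// eq_complex/= Re_sum Im_sum.
  by apply/andP; split; apply/eqP; apply: eq_bigr => j _; rewrite ?Re_realM ?Im_realM mulrC.
have mu0 x : measurable [set w | lincomb X x w = 0].
  exact: (@measurable_lincomb_set _ _ _ _ _ X x [set 0]).
have mA : measurable A by exact: measurableI.
have PA : P A = 0%E.
  have [u0|u0] := eqVneq (\sum_i u i ^+ 2) 0; last first.
    apply/eqP; rewrite eq_le measure_ge0 andbT -(lincomb_eq0 indX stdX (u := u)).
      by apply: le_measure; rewrite ?inE//; exact: subIsetl.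
    by rewrite lt_neqAle eq_sym u0 sumr_ge0// => j _; exact: sqr_ge0.
  have v0 : 0 < \sum_i v i ^+ 2.
    have ui0 : u i = 0.
      move: u0; rewrite (bigD1 i)//= => /eqP.
      rewrite paddr_eq0 ?sqr_ge0//; last by apply: sumr_ge0 => j _; exact: sqr_ge0.
      by rewrite sqrf_eq0 => /andP[/eqP].
    have vi0 : v i != 0.
      by apply: contra ai0 => /eqP vi0; rewrite eq_complex/= -/(u i) -/(v i) ui0 vi0 eqxx.
    rewrite (bigD1 i)//= ltr_pwDl//; last by apply: sumr_ge0 => j _; exact: sqr_ge0.
    by rewrite lt_neqAle sqr_ge0 andbT eq_sym sqrf_eq0.
  apply/eqP; rewrite eq_le measure_ge0 andbT -(lincomb_eq0 indX stdX v0).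
  by apply: le_measure; rewrite ?inE//; exact: subIsetr.
exists A; split => //.
move=> w /= wA; apply: contrapT => nA; apply: wA.
have FwD0 : F w D%:Z != 0.
  apply/eqP; rewrite FwD => -[u0 v0]; exact: nA.
apply: root_count_degree => //.
rewrite FwE//.
have -> : \sum_i (X i w)%:C%C * a i (- D%:Z) = (F w D%:Z)^*%C.
  rewrite FwE// rmorph_sum/=; apply: eq_bigr => j _.
  have [aJ _] := aP j; rewrite aJ// rmorphM/=; congr (_ * _).
  by rewrite oppr0.
by rewrite conjc_eq0.
Qed.

(** [xget] returns this value because it is the only one: for a second almost sure value the two
    exceptional null sets would cover the whole space. *)
Lemma as_root_countE : as_root_count P L F = (2 * D)%N.
Proof.
rewrite /as_root_count; apply: xget_unique; first exact: ae_root_count.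
move=> N [A [mA A0 hA]]; have [B [mB B0 hB]] := ae_root_count.
apply: contrapT => NE.
have : P (A `|` B) = 1%E.
  rewrite -(probability_setT P); congr (P _); apply/seteqP; split => // w _.
  have [NwE|NwE] := eqVneq (root_count L (F w)) N.
    by right; apply: hB => /= h; apply: NE; rewrite -NwE h.
  by left; apply: hA => /= h; rewrite h eqxx in NwE.
by rewrite measureU0// => PA1; have /eqP := etrans (esym PA1) A0; rewrite onee_eq0.
Qed.

Lemma prob_root_realE : L != [fset 0]%fset ->
  prob_root_real P L F = ((D%:R)^-1 *
    Num.sqrt ((#|` L|%:R)^-1 * \sum_(l <- L) (l%:~R : R) ^+ 2))%:E.
Proof.
move=> L00; rewrite /prob_root_real as_root_countE.
have [e [X [eON indX stdX FE]]] := F_random.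
rewrite (expected_real_rootsE L_sym L_neq0 eON indX stdX FE) -EFinM; congr EFin.
have D0 : D%:R != 0 :> R by rewrite pnatr_eq0 -lt0n degree_gt0.
by rewrite natrM; field.
Qed.

End RootCount.

(** * Dilation of the spectrum *)

Section Scale.
Context {R : realType} (L : {fset int}) (k : int).
Hypothesis k_neq0 : k != 0.

Let kinj : injective (fun l : int => k * l).
Proof. exact: mulfI. Qed.

Lemma card_scale_spectrum : #|` scale_spectrum k L| = #|` L|.
Proof. by rewrite /scale_spectrum card_imfset. Qed.

Lemma mem_scale_spectrum l : (k * l \in scale_spectrum k L) = (l \in L).
Proof. by rewrite /scale_spectrum mem_imfset. Qed.

Lemma scale_spectrum_sym : (forall l, l \in L -> - l \in L) ->
  forall l, l \in scale_spectrum k L -> - l \in scale_spectrum k L.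
Proof.
move=> Ls l /imfsetP[m /= mL ->]; rewrite -mulrN mem_scale_spectrum; exact: Ls.
Qed.

Lemma scale_spectrum_neq0 : L != fset0 -> scale_spectrum k L != fset0.
Proof. by rewrite -!cardfs_gt0 card_scale_spectrum. Qed.

Lemma scale_spectrum_neq_set0 : L != [fset 0]%fset -> scale_spectrum k L != [fset 0]%fset.
Proof.
apply: contra => /eqP kL; apply/eqP/fsetP => l.
by rewrite -mem_scale_spectrum kL !inE mulf_eq0 (negbTE k_neq0).
Qed.

Lemma degree_scale_spectrum : degree (scale_spectrum k L) = (`|k| * degree L)%N.
Proof.
rewrite /degree /scale_spectrum big_imfset/=; last by move=> x y _ _; exact: kinj.
rewrite (big_morph (muln `|k|%N) (maxnMr _) (muln0 _)).
by apply: eq_bigr => l _; rewrite abszM.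
Qed.

Lemma sum_scale_spectrum :
  \sum_(l <- scale_spectrum k L) (l%:~R : R) ^+ 2 =
  k%:~R ^+ 2 * \sum_(l <- L) (l%:~R : R) ^+ 2.
Proof.
rewrite /scale_spectrum big_imfset/=; last by move=> x y _ _; exact: kinj.
by rewrite mulr_sumr; apply: eq_bigr => l _; rewrite intrM exprMn.
Qed.

End Scale.


Theorem theorem3 (R : realType) (L : {fset int})
  (L_sym : forall l, l \in L -> - l \in L)
  (L_neq0 : L != fset0) (L_neq_set0 : L != [fset 0]%fset)
  (d : measure_display) (T : measurableType d) (P : probability T R)
  (F : T -> int -> R[i]) (F_random : random_real_laurent P L F) :
  let rms : R :=
    Num.sqrt ((#|` L|%:R)^-1 * \sum_(l <- L) (l%:~R : R) ^+ 2) in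
  [/\ expected_real_roots P L F = (2 * rms)%:E,
      prob_root_real P L F = ((degree L)%:R^-1 * rms)%:E
    & forall k : int, k != 0 ->
      forall (d' : measure_display) (T' : measurableType d')
        (P' : probability T' R) (G : T' -> int -> R[i]),
        random_real_laurent P' (scale_spectrum k L) G ->
        prob_root_real P' (scale_spectrum k L) G = prob_root_real P L F].
Proof.
move=> rms; split.
- have [e [X [eON indX stdX FE]]] := F_random.
  exact: (expected_real_rootsE L_sym L_neq0 eON indX stdX FE).
- exact: (prob_root_realE L_sym L_neq0 F_random L_neq_set0).
move=> k k0 d' T' P' G G_random.
rewrite (prob_root_realE L_sym L_neq0 F_random L_neq_set0).
rewrite (prob_root_realE (scale_spectrum_sym k0 L_sym)
  (scale_spectrum_neq0 k0 L_neq0) G_random (scale_spectrum_neq_set0 k0 L_neq_set0)).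
rewrite card_scale_spectrum// degree_scale_spectrum// sum_scale_spectrum//.
have kR0 : `|k|%N%:R != 0 :> R by rewrite pnatr_eq0 absz_eq0.
(* The degree and the root mean square are both multiplied by |k|, which cancels in the quotient. *)
congr EFin; rewrite mulrCA sqrtrM ?sqr_ge0// sqrtr_sqr natrM invfM.
have -> : `|k%:~R| = `|k|%N%:R :> R by rewrite -intr_norm -abszE.
by rewrite mulrACA mulVf// mul1r.
Qed.
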